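(* Let $\mathcal{E}$ be an algebraically closed complete local field, so that $\mathcal{E}$ is the field of fractions of a principal ideal domain $U$, where $U$ has a maximal ideal $P$ and $\mathcal{F}=U/P$ is a field of prime characteristic $p$. Let $A$ be a finite-dimensional associative algebra over $\mathcal{E}$ with an order $\mathcal{D}\subset A$, and let $\bar{\mathcal{D}}=\mathcal{D}/P\mathcal{D}$, an algebra over $\mathcal{F}$. Let $C$ be the Cartan matrix of $\mathcal{D}$ (over $\mathcal{E}$), let $\tilde{C}$ be the Cartan matrix of $\bar{\mathcal{D}}$ (over $\mathcal{F}$), and let $D$ be the decomposition matrix relating $\mathcal{D}$ and $\bar{\mathcal{D}}$. Then $$\tilde{C}=D^{T}CD.$$
   Context: An order $\mathcal{D}$ in $A$ is a subring that is a finitely generated free $U$-module spanning $A$ over $\mathcal{E}$. For every $\mathcal{D}$-module $M$, $\bar{M}=M/PM$ is a $\bar{\mathcal{D}}$-module in a natural way. Principal indecomposable modules are the indecomposable direct summands of the regular module. Let $P_1,\dots,P_r$ be a full set of principal indecomposable modules for $\mathcal{D}$ over $\mathcal{E}$, with associated irreducible modules $T_1,\dots,T_r$: each $P_i$ has a unique maximal submodule $\mathrm{rad}(P_i)$, and $T_i\cong P_i/\mathrm{rad}(P_i)$. The Cartan matrix $C=(c_{ij})$ of $\mathcal{D}$ is the $r\times r$ matrix whose $(i,j)$ entry is the number of times that $T_j$ occurs as a composition factor of $P_i$; it is known that $c_{ij}=\dim_{\mathcal{E}}\mathrm{Hom}(P_j,P_i)$. In the same way, let $Q_1,\dots,Q_s$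 be a full set of principal indecomposable modules for $\bar{\mathcal{D}}$ over $\mathcal{F}$ with associated irreducible modules $U_1,\dots,U_s$; the Cartan matrix $\tilde{C}=(\tilde{c}_{ij})$ of $\bar{\mathcal{D}}$ is the $s\times s$ matrix with $\tilde{c}_{ij}=\dim_{\mathcal{F}}\mathrm{Hom}(Q_j,Q_i)$. The decomposition matrix $D=(d_{ij})$ is the $r\times s$ matrix in which $d_{ij}$ is the number of composition factors of $\bar{T}_i$ isomorphic to $U_j$, where $\bar{T}_i=T_i/PT_i$ is the reduction modulo $P$ of the irreducible $\mathcal{D}$-module $T_i$ (with $T_i$ understood as given by a $\mathcal{D}$-stable full $U$-lattice). *)

(* Defs.v *)
(* MathComp world, with the classical layer and the reals of MathComp-Analysis. *)
From HB Require Import structures.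
From mathcomp Require Import all_boot all_order all_algebra all_field.
From mathcomp Require Import boolp classical_sets reals.

Set Implicit Arguments.
Unset Strict Implicit.
Unset Printing Implicit Defensive.

Import Order.TTheory GRing.Theory Num.Theory.

Local Open Scope ring_scope.

(** * Complete valued fields *)

Definition nonarch_absval (R : realType) (E : fieldType) (v : E -> R) : Prop :=
  [/\ forall x, 0 <= v x,
      forall x, v x = 0 <-> x = 0,
      forall x y, v (x * y) = v x * v y
    & forall x y, v (x + y) <= Num.max (v x) (v y)].

Definition absval_complete (R : realType) (E : fieldType) (v : E -> R) : Prop :=
  forall u : nat -> E,
    (forall e : R, 0 < e -> exists N : nat, forall m n : nat,
        (N <= m)%N -> (N <= n)%N -> v (u m - u n) < e) ->
    exists l : E, forall e : R, 0 < e -> exists N : nat, forall n : nat,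
        (N <= n)%N -> v (u n - l) < e.

(* The ring of integers U, whose field of fractions is E, and its unique
   maximal ideal P.  U is a Bezout domain.  It is not required to be Noetherian:
   the value group of an algebraically closed field is divisible, so no
   nontrivial absolute value on such a field is discrete. *)
Definition valring (R : realType) (E : fieldType) (v : E -> R) : {pred E} :=
  [pred x | v x <= 1].

Definition valideal (R : realType) (E : fieldType) (v : E -> R) : {pred E} :=
  [pred x | v x < 1].

(** * Modules over a finite-dimensional algebra *)

Section Modules.

Variables (K : fieldType) (A : falgType K).

(* Finite-dimensional left modules.  The products in 'End(M) and A are in
   opposite orders in the library, hence the explicit composition. *)
Record amodule := AModule {
  amod_sort :> vectType K;
  act : {linear A -> 'End(amod_sort)};
  act1 : act 1 = \1%VF;
  actM : forall a b : A, act (a * b) = (act a \o act b)%VF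
}.

Fact regular_act1 : amull (1 : A) = \1%VF.
Proof. exact: amull1. Qed.

Fact regular_actM (a b : A) : amull (a * b) = (amull a \o amull b)%VF.
Proof. exact: amullM. Qed.

Definition regular_amod : amodule := AModule regular_act1 regular_actM.

Definition submod (M : amodule) (N : {vspace M}) : Prop :=
  forall (a : A) (x : M), x \in N -> act M a x \in N.

(* N2 / N1 is isomorphic to T.  Only the restriction of f to N2 matters; every
   linear map on N2 extends to M. *)
Definition quot_iso (M T : amodule) (N1 N2 : {vspace M}) : Prop :=
  exists f : 'Hom(M, T),
    [/\ forall (a : A) (x : M), x \in N2 -> f (act M a x) = act T a (f x),
        (f @: N2 = fullv)%VS
      & (lker f :&: N2 = N1)%VS].

Definition mod_iso (M N : amodule) : Prop := quot_iso N (0 : {vspace M}) fullv.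

Definition indecomposable (M : amodule) : Prop :=
  (fullv : {vspace M}) <> 0%VS /\
  forall N1 N2 : {vspace M}, submod N1 -> submod N2 ->
    (N1 + N2 = fullv)%VS -> (N1 :&: N2 = 0)%VS -> N1 = 0%VS \/ N2 = 0%VS.

Definition principal_indecomposable (M : amodule) : Prop :=
  indecomposable M /\
  exists I J : {vspace regular_amod},
    [/\ submod I, submod J, (I + J = fullv)%VS, (I :&: J = 0)%VS
      & quot_iso M 0%VS I].

Definition full_set_of_pims (r : nat) (P : 'I_r -> amodule) : Prop :=
  [/\ forall i, principal_indecomposable (P i),
      forall i j, mod_iso (P i) (P j) -> i = j
    & forall M, principal_indecomposable M -> exists i, mod_iso M (P i)].

Definition maximal_in (M : amodule) (N1 N2 : {vspace M}) : Prop :=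
  [/\ submod N1, (N1 <= N2)%VS, N1 <> N2
    & forall N : {vspace M}, submod N -> (N1 <= N)%VS -> (N <= N2)%VS ->
        N = N1 \/ N = N2].

Definition is_radical (M : amodule) (N : {vspace M}) : Prop :=
  maximal_in N fullv /\
  forall N' : {vspace M}, maximal_in N' fullv -> N' = N.

Definition is_head (M T : amodule) : Prop :=
  exists N : {vspace M}, is_radical N /\ quot_iso T N fullv.

Definition composition_series (M : amodule) (k : nat) (N : nat -> {vspace M}) :
    Prop :=
  [/\ N 0 = 0%VS, N k = fullv & forall i, (i < k)%N -> maximal_in (N i) (N i.+1)].

(* The number of factors isomorphic to T in some composition series of M; it
   does not depend on the series, by the Jordan-Hoelder theorem. *)
Definition comp_mult (M T : amodule) : nat :=
  xget 0%N [set n : nat | exists (k : nat) (N : nat -> {vspace M}),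
    composition_series k N /\
    n = #|[set i : 'I_k | `[< quot_iso T (N i) (N i.+1) >]]%SET|].

Definition hom_defect (M N : amodule) (a : A) (f : 'Hom(M, N)) : 'Hom(M, N) :=
  (f \o act M a)%VF - (act N a \o f)%VF.

Definition homs (M N : amodule) : {vspace 'Hom(M, N)} :=
  (\bigcap_(i < \dim {:A}) lker (linfun (@hom_defect M N (vbasis {:A})`_i)))%VS.

Fact hom_defect_linear (M N : amodule) (a : A) : linear (@hom_defect M N a).
Proof.
move=> k f g; rewrite /hom_defect comp_lfunDl comp_lfunDr -comp_lfunZl -comp_lfunZr.
by rewrite scalerBr opprD addrACA.
Qed.

Lemma memv_homs (M N : amodule) (f : 'Hom(M, N)) :
  f \in homs M N <-> forall (a : A) (x : M), f (act M a x) = act N a (f x).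
Proof.
pose L a := GRing.isLinear.Build K 'Hom(M, N) 'Hom(M, N) *:%R
  (@hom_defect M N a) (@hom_defect_linear M N a).
pose dL a : {linear 'Hom(M, N) -> 'Hom(M, N)} := HB.pack (@hom_defect M N a) (L a).
have kerE a : (f \in lker (linfun (@hom_defect M N a))) = (hom_defect a f == 0).
  by rewrite memv_ker (lfunE (dL a)).
have defP a : (hom_defect a f == 0) <->
    forall x : M, f (act M a x) = act N a (f x).
  rewrite /hom_defect subr_eq0; split=> [/eqP/lfunP fE x | fE].
    by have := fE x; rewrite !comp_lfunE.
  by apply/eqP/lfunP=> x; rewrite !comp_lfunE.
split=> [fH a x | fH].
  rewrite (coord_vbasis (memvf a)) !linear_sum !sum_lfunE linear_sum.
  apply: eq_bigr => i _; rewrite !linearZ /= !lfunE /= linearZ; congr (_ *: _).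
  move: x; apply/defP; rewrite -kerE memvE.
  by rewrite memvE in fH; apply: (subv_bigcapP fH).
by rewrite memvE; apply/subv_bigcapP=> i _; rewrite -memvE kerE; apply/defP.
Qed.

Definition dim_hom (M N : amodule) : nat := \dim (homs M N).

End Modules.

(** * Lattices and reduction modulo the maximal ideal *)

Section Reduction.

Variables (E : fieldType) (U P : {pred E}).

(* A finitely generated free U-submodule of V that spans V over E. *)
Definition full_lattice (V : vectType E) (L : {pred V}) : Prop :=
  exists (n : nat) (b : n.-tuple V),
    [/\ forall c : 'I_n -> E, (forall i, c i \in U) ->
          \sum_i c i *: b`_i = 0 -> forall i, c i = 0,
        forall x : V, x \in L <->
          exists2 c : 'I_n -> E, (forall i, c i \in U) & x = \sum_i c i *: b`_i
      & (<<b>> = fullv)%VS].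

Definition is_order (A : falgType E) (D : {pred A}) : Prop :=
  subring_closed D /\ full_lattice D.

(* Membership in P L. *)
Definition in_ideal_mul (V : vectType E) (L : {pred V}) (x : V) : Prop :=
  exists (n : nat) (c : 'I_n -> E) (y : 'I_n -> V),
    [/\ forall i, c i \in P, forall i, y i \in L & x = \sum_i c i *: y i].

Variable F : fieldType.

(* The next four predicates present the quotients U / P, L / P L, D / P D and
   T / P T as targets of surjective homomorphisms whose kernels are the
   indicated ideal or submodules.  The maps are total functions on the ambient
   spaces, and only their values on U, L, D matter. *)
Definition residue_map (red : E -> F) : Prop :=
  [/\ red 1 = 1,
      {in U &, {morph red : x y / x + y}},
      {in U &, {morph red : x y / x * y}},
      forall y : F, exists2 x, x \in U & red x = y
    & forall x, x \in U -> (red x = 0 <-> x \in P)].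

Variable red : E -> F.

Definition lattice_reduction (V : vectType E) (L : {pred V})
    (W : vectType F) (g : V -> W) : Prop :=
  [/\ {in L &, {morph g : x y / x + y}},
      forall u x, u \in U -> x \in L -> g (u *: x) = red u *: g x,
      forall y : W, exists2 x, x \in L & g x = y
    & forall x, x \in L -> (g x = 0 <-> in_ideal_mul L x)].

Definition order_reduction (A : falgType E) (D : {pred A})
    (Dbar : falgType F) (redD : A -> Dbar) : Prop :=
  [/\ lattice_reduction D redD,
      redD 1 = 1
    & {in D &, {morph redD : x y / x * y}}].

Definition stable_lattice (A : falgType E) (D : {pred A})
    (T : amodule A) (L : {pred T}) : Prop :=
  full_lattice L /\
  forall (d : A) (x : T), d \in D -> x \in L -> act T d x \in L.

Definition module_reduction (A : falgType E) (D : {pred A})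
    (Dbar : falgType F) (redD : A -> Dbar)
    (T : amodule A) (L : {pred T}) (Tbar : amodule Dbar) (redT : T -> Tbar) :
    Prop :=
  lattice_reduction L redT /\
  forall (d : A) (x : T), d \in D -> x \in L ->
    redT (act T d x) = act Tbar (redD d) (redT x).

End Reduction.

(** * Cartan and decomposition matrices *)

Definition cartan_mx (K : fieldType) (A : falgType K) (r : nat)
    (P T : 'I_r -> amodule A) : 'M[nat]_r :=
  \matrix_(i, j) comp_mult (P i) (T j).

Definition cartan_hom_mx (K : fieldType) (A : falgType K) (s : nat)
    (Q : 'I_s -> amodule A) : 'M[nat]_s :=
  \matrix_(i, j) dim_hom (Q j) (Q i).

Definition decomposition_mx (K : fieldType) (A : falgType K) (r s : nat)
    (Tbar : 'I_r -> amodule A) (S : 'I_s -> amodule A) : 'M[nat]_(r, s) :=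
  \matrix_(i, j) comp_mult (Tbar i) (S j).

(* Main.v *)
(* Idempotents lift from Dbar to D, because E is complete: Newton's iteration
   x |-> 3x^2 - 2x^3 for the equation x^2 = x converges.  So a principal
   indecomposable module Q_j = Dbar ebar_j comes from an idempotent e_j of D, and
   the dimensions of e_j A e_i and e_j T_k over E equal those of
   ebar_j Dbar ebar_i and ebar_j Tbar_k over F, as a lattice reduces to a space of
   the same dimension.  The first is the dimension of hom(Q_j, Q_i).  The second
   is d_kj: for a primitive idempotent f and a module M over an algebraically
   closed field, f M = hom(A f, M) has as its dimension, by Schur's lemma, the
   number of composition factors of M isomorphic to the head of A f (and F is
   algebraically closed since E is).  Splitting e_i and e_j into primitive
   idempotents of A, where A e_i contains P_l with multiplicity
   dim e_i T_l = d_li, gives dim e_j A e_i = sum_(k, l) d_li c_lk d_kj. *)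
Require Import Defs.
From HB Require Import structures.
From mathcomp Require Import all_boot all_order all_algebra all_field.
From mathcomp Require Import boolp classical_sets reals.
From mathcomp Require Import ring lra.

Set Implicit Arguments.
Unset Strict Implicit.
Unset Printing Implicit Defensive.

Import Order.TTheory GRing.Theory Num.Theory.

Local Open Scope ring_scope.


(** * Modules and idempotents *)

Section LinearAlgebra.

Import VectorInternalTheory.

Variables (K : fieldType) (V W X : vectType K).

(** [f^-1] picks some preimage of [f x]; it differs from [x] by an element of the kernel of [f],
    which [g] kills. This is how maps are factored through quotients below. *)
Lemma lfun_factor (f : 'Hom(V, W)) (g : 'Hom(V, X)) (x : V) :
  (lker f <= lker g)%VS -> g (f^-1%VF (f x)) = g x.
Proof.
move=> /subvP fg; apply/eqP; rewrite -subr_eq0 -linearB -memv_ker fg //.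
by rewrite memv_ker linearB /= limg_lfunVK ?subrr // memv_img ?memvf.
Qed.

Lemma mem_limg_idem (f : 'End(V)) (x : V) :
  (forall y, f (f y) = f y) -> (x \in limg f) = (f x == x).
Proof.
move=> ff; apply/idP/eqP => [/memv_imgP[y _ ->] | <-]; first exact: ff.
by rewrite memv_img ?memvf.
Qed.

(** Rank-nullity, since the kernel of the projection [f] is the image of the complementary
    projection. *)
Lemma dim_limg_idem (f : 'End(V)) (f' := \1%VF - f) :
  (forall x, f (f x) = f x) ->
  \dim {:V} = (\dim (limg f') + \dim (limg f))%N.
Proof.
move=> ff; have f'E x : f' x = x - f x by rewrite add_lfunE opp_lfunE id_lfunE.
rewrite -(limg_ker_dim f fullv) capfv; congr (\dim _ + _)%N.
apply/vspaceP=> x; rewrite memv_ker mem_limg_idem => [|y].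
  by rewrite f'E subr_eq addrC -subr_eq subrr eq_sym.
by rewrite !f'E linearB /= ff subrr subr0.
Qed.

(** The characteristic polynomial is monic of positive degree, so it has a root. Closedness is a
    hypothesis on a plain field so that it can be used for the residue field too. *)
Lemma vect_closed_eigenvector (f : 'End(V)) :
  GRing.closed_field_axiom K -> (0 < \dim {:V})%N ->
  exists (l : K) (x : V), x != 0 /\ f x = l *: x.
Proof.
move=> closedK; rewrite dimvf => V_gt0.
have [l] := closedK (dim V) (fun i => - (char_poly (f2mx f))`_i) V_gt0.
move=> lE; have : eigenvalue (f2mx f) l.
  rewrite eigenvalue_root_char /root horner_coef size_char_poly big_ord_recr /=.
  have := char_poly_monic (f2mx f).
  rewrite monicE lead_coefE size_char_poly /= => /eqP ->.
  rewrite mul1r lE -big_split /= big1 ?eqxx // => i _.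
  by rewrite mulNr subrr.
move=> /eigenvalueP[u uE u_neq0]; exists l, (r2v u); split.
  apply: contraNneq u_neq0 => u0.
  by apply/eqP/r2v_inj; rewrite u0 linear0.
by rewrite unlock /= r2vK uE linearZ.
Qed.

End LinearAlgebra.

Section Modules.

Variables (K : fieldType) (A : falgType K).
Implicit Types (M N T : amodule A) (a b e : A).

Lemma actME M a b x : act M (a * b) x = act M a (act M b x).
Proof. by rewrite actM comp_lfunE. Qed.

Lemma act1E M x : act M 1 x = x.
Proof. by rewrite act1 id_lfunE. Qed.

Lemma act0E M x : act M 0 x = 0.
Proof. by rewrite linear0 zero_lfunE. Qed.

Lemma actDE M a b x : act M (a + b) x = act M a x + act M b x.
Proof. by rewrite linearD add_lfunE. Qed.

Lemma regular_actE a (x : regular_amod A) : act (regular_amod A) a x = a * x.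
Proof. by rewrite /= lfunE. Qed.

Definition equivariant M N (f : 'Hom(M, N)) : Prop :=
  forall a x, f (act M a x) = act N a (f x).

Lemma submod_lker M N (f : 'Hom(M, N)) : equivariant f -> submod (lker f).
Proof.
by move=> fA a x; rewrite !memv_ker fA => /eqP->; rewrite linear0.
Qed.

Lemma submod_limg M N (f : 'Hom(M, N)) (M' : {vspace M}) :
  equivariant f -> submod M' -> submod (f @: M').
Proof.
move=> fA M'A a x /memv_imgP[y yM' ->]; rewrite -fA.
by rewrite memv_img ?M'A.
Qed.

Lemma submod_preim M N (f : 'Hom(M, N)) (N' : {vspace N}) :
  equivariant f -> submod N' -> submod (f @^-1: N').
Proof.
by move=> fA N'A a x; rewrite -!memv_preim fA => /N'A.
Qed.

Lemma submod_full M : submod (fullv : {vspace M}).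
Proof. by move=> a x _; rewrite memvf. Qed.

Lemma submod0 M : submod (0%VS : {vspace M}).
Proof. by move=> a x; rewrite !memv0 => /eqP->; rewrite linear0. Qed.

Lemma submodD M (N1 N2 : {vspace M}) : submod N1 -> submod N2 -> submod (N1 + N2).
Proof.
move=> N1A N2A a _ /memv_addP[x1 x1N [x2 x2N ->]].
by rewrite linearD memv_add ?N1A ?N2A.
Qed.

Section Orbit.

Variables (M : amodule A) (m : M).

Definition orbit_fun (a : regular_amod A) : M := act M a m.

Fact orbit_fun_is_linear : linear orbit_fun.
Proof. by move=> k a b; rewrite /orbit_fun linearP add_lfunE scale_lfunE. Qed.

HB.instance Definition _ :=
  GRing.isLinear.Build K (regular_amod A) M *:%R orbit_fun orbit_fun_is_linear.

Definition orbit_lfun : 'Hom(regular_amod A, M) := linfun orbit_fun.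

Lemma orbit_lfunE a : orbit_lfun a = act M a m.
Proof. by rewrite lfunE. Qed.

End Orbit.

(* M is isomorphic to A e through a e |-> a m. *)
Definition presents M e (m : M) : Prop :=
  [/\ e * e = e, act M e m = m, forall x : M, exists a, x = act M a m
    & forall a, act M a m = 0 -> a * e = 0].

(** The map [a m |-> a n] is well defined: [a m = 0] gives [a e = 0], hence [a n = a e n = 0]. *)
Lemma presents_hom M N e (m : M) (n : N) :
  presents e m -> act N e n = n ->
  exists f : 'Hom(M, N), equivariant f /\ f m = n.
Proof.
move=> [ee em Mm me] en.
pose f := (orbit_lfun n \o (orbit_lfun m)^-1)%VF.
have fE a : f (act M a m) = act N a n.
  rewrite /f comp_lfunE -!orbit_lfunE lfun_factor //.
  apply/subvP=> b; rewrite !memv_ker !orbit_lfunE => /eqP/me be0.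
  by rewrite -en -actME be0 act0E.
exists f; split; last by rewrite -{1}em fE en.
by move=> a x; have [b ->] := Mm x; rewrite -actME !fE actME.
Qed.

Definition idem_part M e : {vspace M} := limg (act M e).

Lemma mem_idem_part M e x :
  e * e = e -> (x \in idem_part M e) = (act M e x == x).
Proof.
by move=> ee; apply: mem_limg_idem => y; rewrite -actME ee.
Qed.

Section Evaluation.

Variables (M N : amodule A) (m : M).

Definition eval_fun (f : 'Hom(M, N)) : N := f m.

Fact eval_fun_is_linear : linear eval_fun.
Proof. by move=> k f g; rewrite /eval_fun add_lfunE scale_lfunE. Qed.

HB.instance Definition _ :=
  GRing.isLinear.Build K 'Hom(M, N) N *:%R eval_fun eval_fun_is_linear.

End Evaluation.

(** Evaluation at [m] is an isomorphism of hom(M, N) onto e N: injective because [m] generates [M],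
    surjective by [presents_hom]. *)
Lemma dim_hom_presents M N e (m : M) :
  presents e m -> dim_hom M N = \dim (idem_part N e).
Proof.
move=> Mem; have [ee em Mm _] := Mem.
pose ev : 'Hom('Hom(M, N), N) := linfun (@eval_fun M N m).
have evE f : ev f = f m by rewrite lfunE.
rewrite /dim_hom -(@limg_dim_eq _ _ _ ev); last first.
  apply/eqP; rewrite -subv0; apply/subvP=> f; rewrite memv_cap memv_ker evE.
  move=> /andP[/memv_homs fA /eqP fm0]; rewrite memv0; apply/eqP/lfunP => x.
  by have [a ->] := Mm x; rewrite fA fm0 linear0 zero_lfunE.
congr (\dim _); apply/vspaceP=> n; rewrite mem_idem_part //.
apply/memv_imgP/eqP => [[f /memv_homs fA ->] | en].
  by rewrite evE -fA em.
have [f [fA fm]] := presents_hom Mem en.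
by exists f; rewrite ?evE //; apply/memv_homs.
Qed.

(** Decompose [1 = e + f] along [I + J]. For [x] in [I], the element [x - x e = x f] lies in both
    [I] and [J], so it vanishes; [x = e] gives idempotence. *)
Lemma summand_idempotent (I J : {vspace regular_amod A}) :
  submod I -> submod J -> (I + J = fullv)%VS -> (I :&: J = 0)%VS ->
  exists e : A, [/\ e * e = e, e \in I & forall x, x \in I -> x * e = x].
Proof.
move=> IA JA IJ IJ0.
have /memv_addP[e eI [f fJ ef1]] : (1 : A) \in (I + J)%VS by rewrite IJ memvf.
have xe x : x \in I -> x * e = x.
  move=> xI; apply/eqP; rewrite eq_sym -subr_eq0 -memv0 -IJ0 memv_cap.
  rewrite {2}(_ : x - x * e = x * f); last first.
    by rewrite -[X in X - _]mulr1 ef1 mulrDr addrC addKr.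
  by rewrite rpredB -?regular_actE ?IA ?JA.
by exists e; split=> //; exact: xe.
Qed.

Lemma quot_iso_presents M (I : {vspace regular_amod A}) e :
  submod I -> e * e = e -> e \in I -> (forall x, x \in I -> x * e = x) ->
  quot_iso M 0%VS I -> exists m : M, presents e m.
Proof.
move=> IA ee eI xe [f [fA fI fker]].
exists (f e); split=> //.
- by rewrite -fA // regular_actE ee.
- move=> x; have : x \in (f @: I)%VS by rewrite fI memvf.
  move=> /memv_imgP[y yI ->]; exists y.
  by rewrite -fA // regular_actE xe.
move=> a; rewrite -fA // => /eqP; rewrite regular_actE -memv_ker => ker.
apply/eqP; rewrite -memv0 -fker memv_cap ker /=.
by rewrite -regular_actE IA.
Qed.

Lemma pim_presents M :
  principal_indecomposable M -> exists e (m : M), presents e m.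
Proof.
move=> [_ [I [J [IA JA IJ IJ0 isoM]]]].
have [e [ee eI xe]] := summand_idempotent IA JA IJ IJ0.
by exists e; apply: quot_iso_presents isoM.
Qed.

Section SubModule.

Variables (M : amodule A) (I : {vspace M}).
Hypothesis IA : submod I.

(** Projecting back to [I] changes nothing when [I] is stable; it only makes the map land in the
    type [subvs_of I]. *)
Definition sub_act a : 'End(subvs_of I) :=
  (linfun (vsproj I) \o act M a \o linfun vsval)%VF.

Fact sub_act_is_linear : linear sub_act.
Proof.
move=> k a b; apply/lfunP=> x; rewrite add_lfunE scale_lfunE.
by rewrite !(comp_lfunE, lfunE) /= linearP add_lfunE scale_lfunE linearP.
Qed.

HB.instance Definition _ :=
  GRing.isLinear.Build K A 'End(subvs_of I) *:%R sub_act sub_act_is_linear.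

Lemma vsval_sub_act a x : vsval (sub_act a x) = act M a (vsval x).
Proof. by rewrite !(comp_lfunE, lfunE) /= vsprojK // IA ?subvsP. Qed.

Fact sub_act1 : sub_act 1 = \1%VF.
Proof.
by apply/lfunP=> x; apply: subvs_inj; rewrite vsval_sub_act act1E id_lfunE.
Qed.

Fact sub_actM a b : sub_act (a * b) = (sub_act a \o sub_act b)%VF.
Proof.
by apply/lfunP=> x; apply: subvs_inj; rewrite comp_lfunE !vsval_sub_act actME.
Qed.

Definition sub_amod : amodule A :=
  @AModule K A (subvs_of I) sub_act sub_act1 sub_actM.

Lemma vsval_act a (x : sub_amod) : vsval (act sub_amod a x) = act M a (vsval x).
Proof. exact: vsval_sub_act. Qed.

End SubModule.

End Modules.


(** * Left ideals of idempotents and primitive decompositions *)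

Section LeftIdeals.

Variables (K : fieldType) (A : falgType K).
Implicit Types (M N T : amodule A) (a b e : A).

(** Passes from an isomorphism on the type of elements of [I] to a map on all of [M], by composing
    with a linear projection onto [I]. *)
Lemma sub_amod_iso M N (I : {vspace M}) (IA : submod I) :
  mod_iso (sub_amod IA) N -> quot_iso N 0%VS I.
Proof.
move=> [h [hA hI hker]]; pose f := (h \o linfun (vsproj I))%VF.
have fE x : f x = h (vsproj I x) by rewrite /f comp_lfunE lfunE.
exists f; split.
- move=> a x xI; rewrite !fE -hA ?memvf //; congr (h _).
  by apply: subvs_inj; rewrite vsval_act // !vsprojK ?IA.
- apply/vspaceP=> y; rewrite memvf; apply/memv_imgP.
  have : y \in (h @: fullv)%VS by rewrite hI memvf.
  move=> /memv_imgP[z _ ->]; exists (vsval z); first exact: subvsP.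
  by rewrite fE vsvalK.
apply/eqP; rewrite -subv0; apply/subvP=> x; rewrite memv_cap memv_ker fE memv0.
move=> /andP[hx0 xI]; have : vsproj I x \in (lker h :&: fullv)%VS.
  by rewrite memv_cap memv_ker hx0 memvf.
by rewrite hker memv0 => /eqP x0; rewrite -(vsprojK xI) x0.
Qed.

Lemma amulrE e (x : regular_amod A) : amulr e x = x * e.
Proof. exact: lfunE. Qed.

Definition left_ideal e : {vspace regular_amod A} := limg (amulr e).

Lemma mem_left_ideal e x : e * e = e -> (x \in left_ideal e) = (x * e == x).
Proof.
move=> ee; rewrite mem_limg_idem => [|y]; first by rewrite amulrE.
by rewrite !amulrE -mulrA ee.
Qed.

Lemma submod_left_ideal e : submod (left_ideal e).
Proof.
move=> a x /memv_imgP[y _ ->]; apply/memv_imgP; exists (a * y); rewrite ?memvf //.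
by rewrite regular_actE !amulrE mulrA.
Qed.

(** The complement of A e in the regular module is A (1 - e). *)
Lemma left_ideal_pim e (eA := @submod_left_ideal e) :
  e * e = e -> indecomposable (sub_amod eA) ->
  principal_indecomposable (sub_amod eA).
Proof.
move=> ee ind; split=> //; have ff : (1 - e) * (1 - e) = 1 - e.
  by rewrite mulrBr mulr1 mulrBl mul1r ee subrr subr0.
exists (left_ideal e), (left_ideal (1 - e)); split.
- exact: submod_left_ideal.
- exact: submod_left_ideal.
- apply/vspaceP=> a; rewrite memvf; apply/memv_addP.
  exists (a * e); first by rewrite mem_left_ideal // -mulrA ee.
  exists (a * (1 - e)); first by rewrite mem_left_ideal // -mulrA ff.
  by rewrite mulrBr mulr1 addrC subrK.
- apply/eqP; rewrite -subv0; apply/subvP=> x; rewrite memv_cap !mem_left_ideal //.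
  rewrite mulrBr mulr1 memv0 => /andP[/eqP-> /eqP <-].
  by rewrite subrr.
have fE x : linfun (vsproj (left_ideal e)) x = vsproj (left_ideal e) x.
  exact: lfunE.
exists (linfun (vsproj (left_ideal e))); split.
- move=> a x xI; rewrite !fE; apply: subvs_inj.
  by rewrite vsval_act !vsprojK ?eA.
- apply/vspaceP=> y; rewrite memvf; apply/memv_imgP.
  by exists (vsval y); rewrite ?subvsP // fE vsvalK.
apply/eqP; rewrite -subv0; apply/subvP=> x; rewrite memv_cap memv_ker fE memv0.
by move=> /andP[/eqP x0 xI]; rewrite -(vsprojK xI) x0.
Qed.

(** If A e is the direct sum of nonzero [N1] and [N2], the components of [e] in them are orthogonal
    idempotents, and each generates a left ideal inside its own summand. *)
Lemma idempotent_split e (eA := @submod_left_ideal e) :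
  e * e = e -> e != 0 -> ~ indecomposable (sub_amod eA) ->
  exists e1 e2 : A, [/\ e1 * e1 = e1, e2 * e2 = e2, e1 * e2 = 0 & e2 * e1 = 0] /\
    [/\ e = e1 + e2, (\dim (left_ideal e1) < \dim (left_ideal e))%N
      & (\dim (left_ideal e2) < \dim (left_ideal e))%N].
Proof.
move=> ee e_neq0 nind; have eI : e \in left_ideal e by rewrite mem_left_ideal ?ee.
have [N1 [N2 [[N1A N2A N12 N120] [N1_neq0 N2_neq0]]]] :
    exists N1 N2 : {vspace sub_amod eA},
    [/\ submod N1, submod N2, (N1 + N2)%VS = fullv & (N1 :&: N2)%VS = 0%VS] /\
    N1 <> 0%VS /\ N2 <> 0%VS.
  apply: contrapT => N12; apply: nind; split=> [full0 | N1 N2 N1A N2A N12f N120].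
    have : vsproj (left_ideal e) e \in (fullv : {vspace sub_amod eA}).
      exact: memvf.
    rewrite full0 memv0 => /eqP e0; move: e_neq0.
    by rewrite -(vsprojK eI) e0 eqxx.
  apply: contrapT => /not_orP[N1_neq0 N2_neq0]; apply: N12.
  by exists N1, N2.
(* For [x] in [N], [x = x e = x n + x n']; the term [x n'] is in [N'] and, being [x - x n], also in
   [N], so it is 0. *)
have sub (N N' : {vspace sub_amod eA}) n n' : submod N -> submod N' ->
    (N :&: N')%VS = 0%VS -> n \in N -> n' \in N' -> vsproj (left_ideal e) e = n + n' ->
    forall x, x \in N -> vsval x * vsval n = vsval x /\ vsval x * vsval n' = 0.
  move=> NA N'A NN' nN n'N' enn' x xN; set a := vsval x : A.
  have ax : act (sub_amod eA) a n + act (sub_amod eA) a n' = x.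
    rewrite -linearD -enn'; apply: subvs_inj.
    rewrite vsval_act vsprojK // regular_actE; apply/eqP.
    by rewrite -mem_left_ideal ?subvsP.
  have an'0 : act (sub_amod eA) a n' = 0.
    apply/eqP; rewrite -memv0 -NN' memv_cap N'A // andbT.
    by rewrite -[X in X \in _](addKr (act (sub_amod eA) a n)) ax rpredD ?rpredN ?NA.
  split; last by rewrite -(regular_actE a) -vsval_act an'0.
  rewrite -(regular_actE a) -vsval_act; congr vsval.
  by rewrite -[RHS]ax an'0 addr0.
have /memv_addP[n1 n1N [n2 n2N en12]] :
    vsproj (left_ideal e) e \in (N1 + N2)%VS by rewrite N12 memvf.
have sub1 := sub _ _ _ _ N1A N2A N120 n1N n2N en12.
have sub2 := sub _ _ _ _ N2A N1A (etrans (capvC _ _) N120) n2N n1N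
  (etrans en12 (addrC _ _)).
have [/sub1[n11 n12] /sub2[n22 n21]] := (n1N, n2N).
have dimE : (\dim N1 + \dim N2 = \dim (left_ideal e))%N.
  by rewrite -dimv_sum_cap N12 N120 dimv0 addn0 dimvf.
have lt_dim (N N' : {vspace sub_amod eA}) n : submod N -> n \in N ->
    (\dim N + \dim N' = \dim (left_ideal e))%N -> N' <> 0%VS ->
    (\dim (left_ideal (vsval n)) < \dim (left_ideal e))%N.
  move=> NA nN <- /eqP; rewrite -dimv_eq0 -lt0n => N'_gt0.
  apply: (@leq_ltn_trans (\dim N)); last by rewrite -[X in (X < _)%N]addn0 ltn_add2l.
  apply: (@leq_trans (\dim (linfun vsval @: N))); last first.
    by rewrite -(limg_ker_dim (linfun vsval) N) leq_addl.
  apply: dimvS; apply/subvP=> _ /memv_imgP[a _ ->]; apply/memv_imgP.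
  exists (act (sub_amod eA) a n); first exact: NA.
  by rewrite amulrE -regular_actE -vsval_act; apply/esym; exact: lfunE.
exists (vsval n1), (vsval n2); split=> //; split.
- by rewrite -[LHS](vsprojK eI) en12.
- exact: lt_dim N1A n1N dimE N2_neq0.
by apply: lt_dim N2A n2N _ N1_neq0; rewrite addnC.
Qed.

Variables (r : nat) (P : 'I_r -> amodule A).
Hypothesis P_pims : full_set_of_pims P.

(** Reduces statements additive over orthogonal idempotents to primitive ones. The induction is on
    the dimension of A e: either A e is indecomposable, hence isomorphic to some [P l], or [e]
    splits into two idempotents with smaller ideals. *)
Lemma idempotent_ind (G : A -> Prop) :
  G 0 ->
  (forall e1 e2, e1 * e1 = e1 -> e2 * e2 = e2 -> e1 * e2 = 0 -> e2 * e1 = 0 ->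
    G e1 -> G e2 -> G (e1 + e2)) ->
  (forall e l (m : P l), presents e m -> G e) ->
  forall e, e * e = e -> G e.
Proof.
move=> G0 GD Gpim e; have [n] := ubnP (\dim (left_ideal e)).
elim: n e => // n IHn e; rewrite ltnS => dim_e ee.
have [-> //|e_neq0] := eqVneq e 0.
have [ind|nind] := pselect (indecomposable (sub_amod (@submod_left_ideal e))).
  have [_ _ Pim] := P_pims; have [l isoM] := Pim _ (left_ideal_pim ee ind).
  have eI : e \in left_ideal e by rewrite mem_left_ideal ?ee.
  have xe x : x \in left_ideal e -> x * e = x.
    by rewrite mem_left_ideal // => /eqP.
  have isoP := sub_amod_iso isoM.
  have [m Pm] := quot_iso_presents (@submod_left_ideal e) ee eI xe isoP.
  exact: Gpim Pm.
have [e1 [e2 [[e11 e22 e12 e21] [eE lt1 lt2]]]] := idempotent_split ee e_neq0 nind.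
rewrite eE; apply: (GD _ _ e11 e22 e12 e21).
  by apply: IHn e11; apply: leq_trans lt1 dim_e.
by apply: IHn e22; apply: leq_trans lt2 dim_e.
Qed.

End LeftIdeals.


(** * Heads and composition factors *)

Section Submodules.

Variables (K : fieldType) (A : falgType K).
Implicit Types (M N T : amodule A) (a b e : A).

Lemma ltv_dim (V : vectType K) (U W : {vspace V}) :
  (U <= W)%VS -> U <> W -> (\dim U < \dim W)%N.
Proof.
by move=> UW /eqP U_neqW; rewrite (ltn_leqif (dimv_leqif_eq UW)).
Qed.

Lemma not_maximal_in M (N1 N2 : {vspace M}) :
  submod N1 -> (N1 <= N2)%VS -> N1 <> N2 -> ~ maximal_in N1 N2 ->
  exists N : {vspace M},
    [/\ submod N, (N1 <= N)%VS, (N <= N2)%VS, N1 <> N & N <> N2].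
Proof.
move=> N1A N12 N1_neq2 nmax; apply: contrapT => noN; apply: nmax; split=> //.
move=> N NA N1N NN2; apply: contrapT => /not_orP[NN1 NneqN2].
by apply: noN; exists N; split=> // /esym.
Qed.

Lemma proper_submod_maximal M (N : {vspace M}) :
  submod N -> N <> fullv -> exists2 N', maximal_in N' fullv & (N <= N')%VS.
Proof.
have [n] := ubnP (\dim {:M} - \dim N); elim: n N => // n IHn N.
rewrite ltnS => dimN NA N_proper.
have [Nmax|nmax] := pselect (maximal_in N fullv); first by exists N.
have [N' [N'A NN' _ NneqN' N'_proper]] :=
  not_maximal_in NA (subvf N) N_proper nmax.
have [|//|//|N'' N''max N'N''] := IHn N'.
  apply: leq_trans dimN; apply: ltn_sub2l; first exact: ltv_dim (subvf N) _.
  exact: ltv_dim.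
by exists N'' => //; apply: subv_trans N'N''.
Qed.

Lemma exists_minimal_above M (N N2 : {vspace M}) :
  submod N -> submod N2 -> (N <= N2)%VS -> N <> N2 ->
  exists2 N', submod N' & maximal_in N N'.
Proof.
move=> NA; have [n] := ubnP (\dim N2); elim: n N2 => // n IHn N2.
rewrite ltnS => dimN2 N2A NN2 NneqN2.
have [Nmax|nmax] := pselect (maximal_in N N2); first by exists N2.
have [N' [N'A NN' N'N2 NneqN' N'_neq]] := not_maximal_in NA NN2 NneqN2 nmax.
by apply: (IHn N') => //; apply: leq_trans dimN2; apply: ltv_dim.
Qed.

Lemma composition_series_exists M :
  exists (k : nat) (N : nat -> {vspace M}), composition_series k N.
Proof.
suff [k [N [N0 Nk Nmax]]] : exists (k : nat) (N : nat -> {vspace M}),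
    [/\ N 0 = 0%VS, N k = fullv
      & forall i, (i < k)%N -> maximal_in (N i) (N i.+1)] by exists k, N.
(* The bottom of the series is generalised from 0 to any submodule, for an induction on its
   codimension. *)
move: (@submod0 _ _ M); move: 0%VS => N0.
have [n] := ubnP (\dim {:M} - \dim N0); elim: n N0 => // n IHn N0.
rewrite ltnS => dimN0 N0A; have [->|/eqP N0_proper] := eqVneq N0 fullv.
  by exists 0%N, (fun=> fullv).
have [N1 N1A N01max] :=
  exists_minimal_above N0A (@submod_full _ _ M) (subvf N0) N0_proper.
have [_ N01 N0_neq1 _] := N01max.
have [|//|k [N [NN1 Nk Nmax]]] := IHn N1.
  apply: leq_trans dimN0; apply: ltn_sub2l; first exact: ltv_dim (subvf N0) _.
  exact: ltv_dim.
exists k.+1, (fun i => if i is j.+1 then N j else N0); split=> // -[|i] /=.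
  by rewrite NN1.
exact: Nmax.
Qed.

Definition simple_module T : Prop :=
  (fullv : {vspace T}) <> 0%VS /\
  forall N : {vspace T}, submod N -> N = 0%VS \/ N = fullv.

(** A Nakayama argument: a proper submodule lies in a maximal one, and [R] is the only maximal
    one. *)
Lemma radical_full M (R N : {vspace M}) :
  is_radical R -> submod N -> ~~ (N <= R)%VS -> N = fullv.
Proof.
move=> [_ Runiq] NA NR; apply: contrapT => N_proper.
have [N' /Runiq -> NR'] := proper_submod_maximal NA N_proper.
by rewrite NR' in NR.
Qed.

Lemma head_map M T : is_head M T ->
  exists R (g : 'Hom(M, T)),
    [/\ is_radical R, equivariant g, limg g = fullv & lker g = R].
Proof.
move=> [R [Rrad [g [gA gT gR]]]]; exists R, g; split=> //.
  by move=> a x; rewrite gA ?memvf.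
by rewrite -gR capvf.
Qed.

Lemma head_simple M T : is_head M T -> simple_module T.
Proof.
move=> /head_map[R [g [[[RA _ R_proper Rmax] _] gA gT gR]]].
have gsurj y : exists x, y = g x.
  have /memv_imgP[x _ ->] : y \in limg g by rewrite gT memvf.
  by exists x.
split=> [T0|N NA].
  apply: R_proper; rewrite -gR; apply/vspaceP=> x.
  by rewrite memv_ker -memv0 -T0 !memvf.
have [|||NR|Nfull] := Rmax (g @^-1: N)%VS.
- exact: submod_preim.
- rewrite -gR; apply/subvP=> x; rewrite memv_ker -memv_preim => /eqP->.
  exact: mem0v.
- exact: subvf.
- left; apply/eqP; rewrite -subv0; apply/subvP=> y; have [x ->] := gsurj y.
  by rewrite memv_preim NR -gR memv_ker memv0.
right; apply/vspaceP=> y; have [x ->] := gsurj y.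
by rewrite memv_preim Nfull !memvf.
Qed.

(** One half of Schur's lemma: the image is a nonzero submodule of the simple [T], so the kernel is
    a maximal submodule of [M], and [R] is the only one. *)
Lemma hom_simple M T (R : {vspace M}) (f : 'Hom(M, T)) :
  is_radical R -> simple_module T -> equivariant f -> f <> 0 ->
  limg f = fullv /\ lker f = R.
Proof.
move=> [_ Runiq] [T_neq0 Tsimple] fA f_neq0.
have fT : limg f = fullv.
  have [f0|//] := Tsimple _ (submod_limg fA (@submod_full _ _ M)).
  case: f_neq0; apply/lfunP=> x; rewrite zero_lfunE; apply/eqP.
  by rewrite -memv0 -f0 memv_img ?memvf.
split=> //; apply: Runiq; split=> [||fker|N NA kerN _].
- exact: submod_lker.
- exact: subvf.
- apply: T_neq0; rewrite -fT; apply/eqP; rewrite -subv0.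
  apply/subvP=> _ /memv_imgP[x _ ->]; rewrite memv0 -memv_ker fker.
  exact: memvf.
have [fN0|fNfull] := Tsimple _ (submod_limg fA NA).
  left; apply/eqP; rewrite eqEsubv kerN andbT; apply/subvP=> x xN.
  by rewrite memv_ker -memv0 -fN0 memv_img.
right; apply/vspaceP=> x; rewrite memvf.
have /memv_imgP[y yN fxy] : f x \in (f @: N)%VS by rewrite fNfull memvf.
rewrite -(subrK y x) rpredD // (subvP kerN) // memv_ker linearB /= fxy.
by rewrite subrr.
Qed.

Lemma presents_head M T e (m : M) (R : {vspace M}) (g : 'Hom(M, T)) :
  presents e m -> is_radical R -> equivariant g -> lker g = R -> g m != 0.
Proof.
move=> [_ _ Mm _] [[_ _ R_proper _] _] gA gR; apply/eqP=> gm0.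
apply: R_proper; rewrite -gR; apply/vspaceP=> x; rewrite memvf memv_ker.
by have [a ->] := Mm x; rewrite gA gm0 linear0 eqxx.
Qed.

(* Schur's lemma for hom(M, T) = e T. *)
Lemma dim_idem_part_head M T e (m : M) :
  GRing.closed_field_axiom K -> presents e m -> is_head M T ->
  \dim (idem_part T e) = 1%N.
Proof.
move=> closedK Mem headT; have Tsimple := head_simple headT.
have [R [g [Rrad gA gT gR]]] := head_map headT; have [ee em Mm _] := Mem.
have gm_neq0 := presents_head Mem Rrad gA gR.
have egm : act T e (g m) = g m by rewrite -gA em.
rewrite (_ : idem_part T e = <[g m]>%VS) ?dim_vline ?gm_neq0 //.
apply/vspaceP=> y; rewrite mem_idem_part //.
apply/eqP/vlineP => [ey|[l ->]]; last by rewrite linearZ /= egm.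
have [f [fA fm]] := presents_hom Mem ey.
(* An eigenvalue [l] of the endomorphism of [T] induced by [f] through [g] is the scalar expected
   from Schur's lemma; [f - l g] is shown to vanish. *)
have [l [z [z_neq0 zE]]] : exists (l : K) (z : T), z != 0 /\
    (f \o g^-1)%VF z = l *: z.
  apply: vect_closed_eigenvector closedK _; rewrite lt0n dimv_eq0.
  by apply/eqP; case: Tsimple.
have [p _ zp] : exists2 p, p \in fullv & z = g p.
  by apply/memv_imgP; rewrite gT memvf.
pose h := f - l *: g; have hA : equivariant h.
  move=> a x; rewrite !(add_lfunE, opp_lfunE, scale_lfunE) fA gA.
  by rewrite linearB; congr (_ - _); apply/esym; exact: linearZ.
have [h0|/eqP h_neq0] := eqVneq h 0.
  exists l; have /lfunP/(_ m) := h0.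
  rewrite !(add_lfunE, opp_lfunE, scale_lfunE, zero_lfunE) fm.
  by move=> /eqP; rewrite subr_eq0 => /eqP.
have [_ hR] := hom_simple Rrad Tsimple hA h_neq0.
have [f0|/eqP f_neq0] := eqVneq f 0.
  by exists 0; rewrite scale0r -fm f0 zero_lfunE.
have [_ fR] := hom_simple Rrad Tsimple fA f_neq0.
(* If [f] and [h] were both nonzero, both would have kernel [R]. Then [h p = 0] by the choice of
   [z = g p], so [p] is in [R] and [z = 0]. *)
case/negP: z_neq0; rewrite zp -memv_ker gR -hR memv_ker.
rewrite !(add_lfunE, opp_lfunE, scale_lfunE) -zp -zE comp_lfunE zp.
by rewrite lfun_factor ?subrr // gR fR.
Qed.

(** The vector [x] gives a surjection [f] of [M] onto [T']. Lifting [f] through [g'], and [g']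
    through [f], gives maps between [M] and [M'] that are onto because their images are not inside
    the radicals. *)
Lemma head_hom_iso M T M' T' e (m : M) e' (m' : M') (x : T') :
  presents e m -> is_head M T -> presents e' m' -> is_head M' T' ->
  act T' e x = x -> x != 0 -> mod_iso M M'.
Proof.
move=> Mem headT Mem' headT' ex x_neq0.
have [ee em Mm _] := Mem; have [ee' em' Mm' _] := Mem'.
have T's := head_simple headT'.
have [R [g [Rrad gA gT gR]]] := head_map headT.
have [R' [g' [Rrad' gA' gT' gR']]] := head_map headT'.
have [f [fA fm]] := presents_hom Mem ex.
have f_neq0 : f <> 0 by move=> f0; rewrite -fm f0 zero_lfunE eqxx in x_neq0.
have [fT' fR] := hom_simple Rrad T's fA f_neq0.
have [x' _ xx'] : exists2 x', x' \in fullv & x = g' x'.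
  by apply/memv_imgP; rewrite gT' memvf.
have [y _ yE] : exists2 y, y \in fullv & g' m' = f y.
  by apply/memv_imgP; rewrite fT' memvf.
have [u [uA um]] : exists u : 'Hom(M, M'), equivariant u /\ u m = act M' e x'.
  by apply: presents_hom Mem _; rewrite -actME ee.
have [w [wA wm]] : exists w : 'Hom(M', M), equivariant w /\ w m' = act M e' y.
  by apply: presents_hom Mem' _; rewrite -actME ee'.
have uM' : limg u = fullv.
  apply: (radical_full Rrad' (submod_limg uA (@submod_full _ _ M))).
  apply/subvPn; exists (u m); first by rewrite memv_img ?memvf.
  by rewrite -gR' memv_ker um gA' -xx' ex.
have wM : limg w = fullv.
  apply: (radical_full Rrad (submod_limg wA (@submod_full _ _ M'))).
  apply/subvPn; exists (w m'); first by rewrite memv_img ?memvf.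
  rewrite -fR memv_ker wm fA -yE -gA' em'.
  exact: presents_head Mem' Rrad' gA' gR'.
exists u; split=> [a z _||]; [exact: uA | exact: uM' |].
(* Surjections both ways force equal dimensions, so [u] is injective. *)
have dimM := limg_ker_dim u fullv; have dimM' := limg_ker_dim w fullv.
apply/eqP; rewrite -dimv_eq0 -leqn0 -(leq_add2r (\dim {:M'})) add0n capvC.
by rewrite -{1}uM' dimM -dimM' wM leq_addl.
Qed.

End Submodules.


(** * Composition multiplicities as dimensions of idempotent parts *)

Section Multiplicities.

Variables (K : fieldType) (A : falgType K).
Hypothesis closedK : GRing.closed_field_axiom K.
Implicit Types (M N : amodule A) (a b e : A).

Lemma mem_idem_sub M (N : {vspace M}) e x : e * e = e -> submod N ->
  (x \in (act M e @: N)%VS) = (x \in N) && (act M e x == x).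
Proof.
move=> ee NA; apply/memv_imgP/andP => [[y yN ->]|[xN /eqP xe]]; last by exists x.
by rewrite NA // -actME ee.
Qed.

(** The map [f] from [P] with [f m = x] has image not inside [N1], so it is onto modulo [N1]. The
    preimage of [N1] is maximal in [P], hence the radical, and [N2 / N1] is the head of [P]. *)
Lemma maximal_in_quot_iso M (P T : amodule A) e (m : P) (N1 N2 : {vspace M}) x :
  presents e m -> is_head P T -> maximal_in N1 N2 -> submod N2 ->
  x \in N2 -> act M e x = x -> x \notin N1 -> quot_iso T N1 N2.
Proof.
move=> Pem headT [N1A N12 _ Nmax] N2A xN2 ex xN1.
have [ee em Pm _] := Pem; have [R [g [[Rmax Runiq] gA gT gR]]] := head_map headT.
have [f [fA fm]] := presents_hom Pem ex.
have fN2 p : f p \in N2 by have [a ->] := Pm p; rewrite fA fm N2A.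
have fPN1 : (limg f + N1 = N2)%VS.
  have [|||/esym N1E|//] := Nmax (limg f + N1)%VS.
  - exact: submodD (submod_limg fA (@submod_full _ _ P)) N1A.
  - exact: addvSr.
  - rewrite subv_add N12 andbT; apply/subvP=> _ /memv_imgP[p _ ->].
    exact: fN2.
  case/negP: xN1; rewrite N1E -fm -[f m]addr0.
  by rewrite memv_add ?mem0v ?memv_img ?memvf.
have kerR : (f @^-1: N1)%VS = R.
  apply: Runiq; split=> [||fN1|S SA NS _].
  - exact: submod_preim.
  - exact: subvf.
  - by case/negP: xN1; rewrite -fm memv_preim fN1 memvf.
  have [|||fSN1|fSN1] := Nmax (f @: S + N1)%VS.
  - exact: submodD (submod_limg fA SA) N1A.
  - exact: addvSr.
  - rewrite subv_add N12 andbT; apply/subvP=> _ /memv_imgP[p _ ->].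
    exact: fN2.
  - left; apply/eqP; rewrite eqEsubv NS andbT; apply/subvP=> p pS.
    rewrite -memv_preim -fSN1 -[f p]addr0.
    by rewrite memv_add ?mem0v ?memv_img.
  (* Write [x = f s + n] with [s] in [S] and [n] in [N1]: then [f (m - s) = n], so [m - s] lies in
     the preimage of [N1], which is inside [S]. *)
  right; have mS : m \in S.
    move: xN2; rewrite -fSN1 => /memv_addP[_ /memv_imgP[s sS ->] [n nN1 xE]].
    rewrite -(subrK s m) rpredD // (subvP NS) // -memv_preim linearB /= fm xE.
    by rewrite addrC addKr.
  by apply/vspaceP=> p; rewrite memvf; have [a ->] := Pm p; rewrite SA.
(* [h] is to send [f p + n] to [g p] for [n] in [N1]. The factor [\1 - projv N1] kills [N1], and the
   kernel of [q] is the preimage of [N1], that is, the kernel of [g]. *)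
pose q := ((\1 - projv N1) \o f)%VF; pose h := (g \o q^-1 \o (\1 - projv N1))%VF.
have piE y : (\1 - projv N1)%VF y = y - projv N1 y.
  by rewrite add_lfunE opp_lfunE id_lfunE.
have pi0 y : y \in N1 -> (\1 - projv N1)%VF y = 0.
  by move=> yN1; rewrite piE projv_id ?subrr.
have hE p n : n \in N1 -> h (f p + n) = g p.
  move=> nN1; rewrite /h 2!comp_lfunE linearD /= (pi0 n) // addr0.
  rewrite -[_ (f p)]comp_lfunE lfun_factor // gR -kerR.
  apply/subvP=> z; rewrite memv_ker comp_lfunE piE -memv_preim subr_eq0.
  by move=> /eqP->; exact: memv_proj.
have N2P y : y \in N2 -> exists p n, n \in N1 /\ y = f p + n.
  by rewrite -fPN1 => /memv_addP[_ /memv_imgP[p _ ->] [n nN1 ->]]; exists p, n.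
exists h; split.
- move=> a y /N2P[p [n [nN1 ->]]].
  by rewrite linearD /= -fA !hE ?N1A // gA.
- apply/vspaceP=> y; rewrite memvf; apply/memv_imgP.
  have /memv_imgP[p _ ->] : y \in limg g by rewrite gT memvf.
  by exists (f p); rewrite ?fN2 // -[f p]addr0 hE ?mem0v.
apply/vspaceP=> y; rewrite memv_cap memv_ker; apply/andP/idP => [[h0]|yN1].
  move=> /N2P[p [n [nN1 yE]]]; move: h0; rewrite yE hE // -memv_ker gR -kerR.
  by rewrite -memv_preim => fpN1; rewrite rpredD.
by rewrite (subvP N12) // -[y]add0r -(linear0 f) hE // linear0.
Qed.

(** Taking e-parts is exact, so the difference is the dimension of e (N2 / N1): 1 when the factor is
    [T]. Otherwise a vector of e N2 outside [N1] would make the factor isomorphic to [T], so the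
    difference is 0. *)
Lemma dim_idem_maximal_in M (P T : amodule A) e (m : P) (N1 N2 : {vspace M}) :
  presents e m -> is_head P T -> maximal_in N1 N2 -> submod N2 ->
  \dim (act M e @: N2) = (\dim (act M e @: N1) + `[< quot_iso T N1 N2 >])%N.
Proof.
move=> Pem headT Nmax N2A; have [ee _ _ _] := Pem.
have [N1A N12 _ _] := Nmax; case: asboolP => [[f [fA fT fker]]|niso].
  rewrite -(limg_ker_dim f (act M e @: N2)); congr (_ + _)%N.
    congr (\dim _); apply/vspaceP=> x; rewrite memv_cap !mem_idem_sub //.
    by rewrite -fker memv_cap andbC andbA.
  apply: etrans (dim_idem_part_head closedK Pem headT); congr (\dim _).
  apply/vspaceP=> y; rewrite mem_idem_part //.
  apply/memv_imgP/eqP => [[x] | ey].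
    by rewrite mem_idem_sub // => /andP[xN2 /eqP ex] ->; rewrite -fA ?ex.
  have /memv_imgP[x xN2 yE] : y \in (f @: N2)%VS by rewrite fT memvf.
  exists (act M e x); first exact: memv_img.
  by rewrite fA // -yE ey.
rewrite addn0; congr (\dim _); apply/vspaceP=> x; rewrite !mem_idem_sub //.
have [ex|] := eqVneq (act M e x) x; last by rewrite !andbF.
rewrite !andbT; apply/idP/idP => [xN2|]; last exact: (subvP N12).
apply: contrapT => /negP xN1; apply: niso.
exact: maximal_in_quot_iso Pem headT Nmax N2A xN2 ex xN1.
Qed.

(** Summing the jumps of dim e N_i along a composition series counts the factors isomorphic to [T].
    The answer is the same for every series, so no appeal to Jordan-Hoelder is made. *)
Lemma comp_mult_head M (P T : amodule A) e (m : P) :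
  presents e m -> is_head P T -> comp_mult M T = \dim (idem_part M e).
Proof.
move=> Pem headT; have count (k : nat) (N : nat -> {vspace M}) :
    composition_series k N ->
    #|[set i : 'I_k | `[< quot_iso T (N i) (N i.+1) >]]%SET| = \dim (idem_part M e).
  move=> [N0 Nk Nmax]; rewrite -sum1dep_card.
  rewrite -(big_mkord (fun i => `[< quot_iso T (N i) (N i.+1) >]) (fun=> 1%N)).
  rewrite /idem_part -Nk; have := leqnn k.
  elim: {1 3 4}k => [|j IHj] jk; first by rewrite big_geq // N0 limg0 dimv0.
  rewrite big_mkcond big_nat_recr //= -big_mkcond IHj 1?ltnW //.
  (* [maximal_in] asserts stability of its lower term only: [N j.+1] is the lower term of the next
     step or, at the top, all of [M]. *)
  have NjA : submod (N j.+1).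
    move: jk; rewrite leq_eqVlt => /predU1P[->|/Nmax[]//].
    by rewrite Nk; apply: submod_full.
  rewrite (dim_idem_maximal_in Pem headT (Nmax _ jk) NjA).
  by congr (_ + _)%N; case: asboolP.
(* Since a series exists, [xget] does not fall back on its default 0. *)
have [k [N Nseries]] := composition_series_exists M.
apply: xget_unique.
  by exists k, N; split=> //; rewrite count.
by move=> _ [k' [N' [N's ->]]]; rewrite count.
Qed.

Variables (r : nat) (P T : 'I_r -> amodule A).
Hypotheses (P_pims : full_set_of_pims P) (T_heads : forall i, is_head (P i) (T i)).

(** For [k != l], a nonzero vector of e (T l) would make [P k] and [P l] isomorphic. *)
Lemma dim_idem_heads k l e (m : P k) :
  presents e m -> \dim (idem_part (T l) e) = (k == l).
Proof.
move=> Pem; have [<-|k_neq_l] := eqVneq k l.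
  exact: dim_idem_part_head Pem (T_heads k).
have [Ppim Piso _] := P_pims; have [el [ml Pl]] := pim_presents (Ppim l).
apply/eqP; rewrite dimv_eq0 -subv0; apply/subvP=> x.
have [ee _ _ _] := Pem; rewrite mem_idem_part // memv0 => /eqP ex.
apply: contraNT k_neq_l => x_neq0; apply/eqP/Piso.
exact: head_hom_iso Pem (T_heads k) Pl (T_heads l) ex x_neq0.
Qed.

Lemma idem_part_orthogonal M e1 e2 : e1 * e1 = e1 -> e2 * e2 = e2 ->
  e1 * e2 = 0 -> e2 * e1 = 0 ->
  \dim (idem_part M (e1 + e2)) = (\dim (idem_part M e1) + \dim (idem_part M e2))%N.
Proof.
move=> e11 e22 e12 e21; rewrite -dimv_disjoint_sum; last first.
  apply/eqP; rewrite -subv0; apply/subvP=> x; rewrite memv_cap !mem_idem_part //.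
  by move=> /andP[/eqP e1x /eqP e2x]; rewrite memv0 -e1x -e2x -actME e12 act0E.
congr (\dim _); apply/vspaceP=> x; rewrite mem_idem_part; last first.
  by rewrite mulrDl !mulrDr e11 e22 e12 e21 addr0 add0r.
apply/eqP/memv_addP => [xE | [x1 + [x2 + ->]]].
  exists (act M e1 x); first by rewrite memv_img ?memvf.
  by exists (act M e2 x); [rewrite memv_img ?memvf | rewrite -actDE xE].
rewrite !mem_idem_part // => /eqP e1x /eqP e2x.
rewrite actDE !linearD /= e1x e2x -{1}e2x -{1}[act M e2 x1](_ : 0 = _) -?actME.
  by rewrite e12 act0E addr0 add0r.
by rewrite -e1x -actME e21 act0E.
Qed.

(* Both sides are additive over orthogonal idempotents, so it suffices to check
   the primitive ones, for which M |-> e M is represented by some P k. *)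
Lemma dim_idem_part_sum M e : e * e = e ->
  \dim (idem_part M e) =
    (\sum_k \dim (idem_part (T k) e) * comp_mult M (T k))%N.
Proof.
move: e; apply: (idempotent_ind P_pims) => [|e1 e2 e11 e22 e12 e21 IH1 IH2|e l m Pem].
- rewrite /idem_part linear0 lim0g dimv0 big1 // => k _.
  by rewrite linear0 lim0g dimv0.
- rewrite idem_part_orthogonal // IH1 IH2 -big_split; apply: eq_bigr => k _ /=.
  by rewrite idem_part_orthogonal // mulnDl.
rewrite (bigD1 l) //= (dim_idem_heads l Pem) eqxx mul1n.
rewrite big1 => [|k /negPf kl]; first by rewrite addn0 (comp_mult_head _ Pem).
by rewrite (dim_idem_heads k Pem) eq_sym kl.
Qed.

Definition corner_lfun e1 e2 : 'End(A) := (amull e1 \o amulr e2)%VF.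

Lemma corner_lfunE e1 e2 x : corner_lfun e1 e2 x = e1 * x * e2.
Proof. by rewrite comp_lfunE !lfunE /= mulrA. Qed.

(** The Peirce component e1 A e2, which for idempotents is hom(A e1, A e2). *)
Definition corner e1 e2 : {vspace A} := limg (corner_lfun e1 e2).

Lemma mem_corner e1 e2 x : e1 * e1 = e1 -> e2 * e2 = e2 ->
  (x \in corner e1 e2) = (e1 * x * e2 == x).
Proof.
move=> e11 e22; rewrite mem_limg_idem => [|y]; rewrite !corner_lfunE //.
by rewrite -!mulrA e22 !mulrA e11.
Qed.

(** The isomorphism [x |-> x m] of A e2 onto [M] carries e1 A e2 onto e1 M. *)
Lemma dim_corner_presents M e1 e2 (m : M) : e1 * e1 = e1 -> presents e2 m ->
  \dim (corner e1 e2) = \dim (idem_part M e1).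
Proof.
move=> e11 [e22 em Mm me].
rewrite -(@limg_dim_eq _ _ _ (orbit_lfun m)); last first.
  apply/eqP; rewrite -subv0; apply/subvP=> x; rewrite memv_cap memv_ker memv0.
  rewrite mem_corner // orbit_lfunE => /andP[/eqP xE /eqP /me xe0].
  by rewrite -xE -mulrA xe0 mulr0.
congr (\dim _); apply/vspaceP=> y; rewrite mem_idem_part //.
apply/memv_imgP/eqP => [[x] | ey].
  rewrite mem_corner // orbit_lfunE => /eqP <- ->.
  by rewrite -actME !mulrA e11.
have [a yE] := Mm y; exists (e1 * a * e2).
  by rewrite mem_corner // -!mulrA e22 !mulrA e11.
by rewrite orbit_lfunE !actME em -yE ey.
Qed.

Lemma dim_corner_orthogonal f e1 e2 : f * f = f -> e1 * e1 = e1 -> e2 * e2 = e2 ->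
  e1 * e2 = 0 -> e2 * e1 = 0 ->
  \dim (corner f (e1 + e2)) = (\dim (corner f e1) + \dim (corner f e2))%N.
Proof.
move=> ff e11 e22 e12 e21; rewrite -dimv_disjoint_sum; last first.
  apply/eqP; rewrite -subv0; apply/subvP=> x; rewrite memv_cap !mem_corner //.
  move=> /andP[/eqP e1x /eqP e2x]; rewrite memv0 -e1x -e2x.
  by rewrite -!mulrA e21 !mulr0.
congr (\dim _); apply/vspaceP=> x; rewrite mem_corner //; last first.
  by rewrite mulrDl !mulrDr e11 e22 e12 e21 addr0 add0r.
apply/eqP/memv_addP => [xE | [x1 + [x2 + ->]]].
  exists (f * x * e1); first by rewrite mem_corner // -!mulrA e11 !mulrA ff.
  exists (f * x * e2); first by rewrite mem_corner // -!mulrA e22 !mulrA ff.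
  by rewrite -mulrDr xE.
rewrite !mem_corner // => /eqP e1x /eqP e2x.
have -> : f * (x1 + x2) * (e1 + e2) = f * x1 * e1 + f * x2 * e2 +
    (f * x1 * e2 + f * x2 * e1).
  by rewrite !mulrDr !mulrDl [X in _ + X]addrC addrACA; congr (_ + _); rewrite addrC.
have -> : f * x1 * e2 = 0 by rewrite -e1x -!mulrA e12 !mulr0.
have -> : f * x2 * e1 = 0 by rewrite -e2x -!mulrA e21 !mulr0.
by rewrite e1x e2x !addr0.
Qed.

(** Dimension count for f A e, where A e contains [P l] with multiplicity dim e (T l). Both sides
    are additive in [e], and for primitive [e] only one term survives. *)
Lemma dim_corner_sum f e : f * f = f -> e * e = e ->
  \dim (corner f e) =
    (\sum_l \dim (idem_part (T l) e) * \dim (idem_part (P l) f))%N.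
Proof.
move=> ff; move: e.
apply: (idempotent_ind P_pims) => [|e1 e2 e11 e22 e12 e21 IH1 IH2|e l m Pem].
- rewrite /corner /corner_lfun linear0 comp_lfun0r lim0g dimv0 big1 // => k _.
  by rewrite /idem_part linear0 lim0g dimv0.
- rewrite dim_corner_orthogonal // IH1 IH2 -big_split; apply: eq_bigr => k _ /=.
  by rewrite idem_part_orthogonal // mulnDl.
rewrite (bigD1 l) //= (dim_idem_heads l Pem) eqxx mul1n (dim_corner_presents ff Pem).
rewrite big1 => [|k /negPf kl]; first by rewrite addn0.
by rewrite (dim_idem_heads k Pem) eq_sym kl.
Qed.

End Multiplicities.


(** * Lattices over a valuation ring *)

Lemma exists_expr_lt (R : realType) (c e : R) :
  0 <= c -> c < 1 -> 0 < e -> exists N : nat, c ^+ N < e.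
Proof.
move=> c_ge0 c_lt1 e_gt0; pose d := 1 - c.
have d_gt0 : 0 < d by rewrite subr_gt0.
(* Bernoulli's inequality in a form without division; with [N] larger than [1 / (e d)] it excludes
   [e <= c ^+ N]. *)
have bernoulli N : c ^+ N * (1 + N%:R * d) <= 1.
  elim: N => [|N IHN]; first by rewrite expr0 mul0r addr0 mulr1.
  apply: le_trans IHN; rewrite exprSr -mulrA ler_wpM2l ?exprn_ge0 //.
  have -> : c = 1 - d by rewrite /d opprB addrC subrK.
  have : 0 <= N%:R :> R := ler0n _ _.
  by rewrite -natr1; nra.
have ed_gt0 : 0 < e * d by rewrite mulr_gt0.
exists (Num.bound (e * d)^-1); set N := Num.bound _.
have Ned : 1 < N%:R * (e * d).
  rewrite -ltr_pdivrMr // div1r.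
  by apply: archi_boundP; rewrite invr_ge0 ltW.
have := bernoulli N; rewrite ltNge => bN; apply/negP => e_le.
have N_ge0 : 0 <= N%:R :> R := ler0n _ _.
have : e * (1 + N%:R * d) <= 1.
  apply: le_trans bN; rewrite ler_wpM2r // addr_ge0 // mulr_ge0 //.
  exact: ltW.
by nra.
Qed.

Section Absval.

Variables (R : realType) (E : fieldType) (v : E -> R).
Hypothesis v_absval : nonarch_absval v.

Lemma absval_ge0 x : 0 <= v x.
Proof. by case: v_absval. Qed.

Lemma absval_eq0 x : v x = 0 -> x = 0.
Proof. by case: v_absval => _ /(_ x)[]. Qed.

Lemma absval0 : v 0 = 0.
Proof. by case: v_absval => _ /(_ 0)[_ ->]. Qed.

Lemma absvalM x y : v (x * y) = v x * v y.
Proof. by case: v_absval. Qed.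

Lemma absvalD x y : v (x + y) <= Num.max (v x) (v y).
Proof. by case: v_absval. Qed.

Lemma absval_gt0 x : x != 0 -> 0 < v x.
Proof.
move=> x_neq0; rewrite lt0r absval_ge0 andbT.
by apply: contra_neq x_neq0 => /absval_eq0.
Qed.

Lemma absval1 : v 1 = 1.
Proof.
have v1_neq0 : v 1 != 0 by rewrite gt_eqF // absval_gt0 ?oner_neq0.
by apply: (mulfI v1_neq0); rewrite -absvalM !mulr1.
Qed.

Lemma absvalX x n : v (x ^+ n) = v x ^+ n.
Proof. by elim: n => [|n IHn]; rewrite ?absval1 // !exprS absvalM IHn. Qed.

Lemma absvalN x : v (- x) = v x.
Proof.
rewrite -mulN1r absvalM (_ : v (- 1) = 1) ?mul1r //.
apply: (@pexpIrn _ 2); rewrite ?nnegrE ?absval_ge0 //.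
by rewrite -absvalX sqrrN expr1n absval1 expr1n.
Qed.

Lemma absvalV x : v x^-1 = (v x)^-1.
Proof.
have [->|x_neq0] := eqVneq x 0; first by rewrite invr0 absval0 invr0.
have vx_neq0 : v x != 0 by rewrite gt_eqF ?absval_gt0.
by apply: (mulfI vx_neq0); rewrite -absvalM !divff // absval1.
Qed.

Lemma absval_sum_le (I : Type) (s : seq I) (f : I -> E) (c : R) :
  0 <= c -> (forall i, v (f i) <= c) -> v (\sum_(i <- s) f i) <= c.
Proof.
move=> c_ge0 fc; elim/big_ind: _ => // [|x y xc yc]; first by rewrite absval0.
by apply: le_trans (absvalD x y) _; rewrite ge_max xc.
Qed.

Lemma absval_sum_lt (I : Type) (s : seq I) (f : I -> E) (c : R) :
  0 < c -> (forall i, v (f i) < c) -> v (\sum_(i <- s) f i) < c.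
Proof.
move=> c_gt0 fc; elim/big_ind: _ => // [|x y xc yc]; first by rewrite absval0.
by apply: le_lt_trans (absvalD x y) _; rewrite gt_max xc.
Qed.

(** Dividing by a coefficient of largest absolute value makes a relation integral with one
    coefficient 1, so it stays nontrivial modulo P. *)
Lemma absval_normalize n (c : 'I_n -> E) :
  (exists i, c i != 0) ->
  exists (d : E) (i : 'I_n), [/\ d != 0, forall j, v (d * c j) <= 1 & d * c i = 1].
Proof.
move=> [i0 ci0]; pose i := [arg max_(i > i0) v (c i)]%O.
have ci j : v (c j) <= v (c i).
  by rewrite /i; case: Order.TotalTheory.arg_maxP => // k _; apply.
have ci_neq0 : c i != 0.
  by apply/eqP=> ci_eq0; have := ci i0; rewrite ci_eq0 absval0 leNgt absval_gt0.
exists (c i)^-1, i; split; rewrite ?invr_eq0 ?mulVf // => j.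
by rewrite absvalM absvalV mulrC ler_pdivrMr ?mul1r ?absval_gt0.
Qed.

(** The lattice becomes the closed unit ball of the sup norm in an E-basis. *)
Definition coord_basis_of (V : vectType E) (L : {pred V}) n (b : n.-tuple V) :
    Prop :=
  basis_of fullv b /\ forall x, x \in L <-> forall i, v (coord b i x) <= 1.

Lemma full_lattice_basis (V : vectType E) (L : {pred V}) :
  full_lattice (valring v) L -> exists n (b : n.-tuple V), coord_basis_of L b.
Proof.
move=> [n [b [indep LE spanb]]]; exists n, b.
have bfree : free b.
  apply/freeP=> c c0 i; apply: contrapT => /eqP ci_neq0.
  have [|d [j [d_neq0 dU dj]]] := @absval_normalize n c; first by exists i.
  have dc0 : \sum_j (d * c j) *: b`_j = 0.
    under eq_bigr do rewrite -scalerA.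
    by rewrite -scaler_sumr c0 scaler0.
  have /eqP := indep (fun j => d * c j) dU dc0 j.
  by rewrite dj oner_eq0.
have bbasis : basis_of fullv b by rewrite basisEfree bfree spanb subvv -spanb dim_span.
split=> // x; split=> [/LE[c cU ->] i | xU].
  rewrite coord_sum_free //; exact: cU.
apply/LE; exists (fun i => coord b i x) => //.
by rewrite {1}(coord_basis bbasis (memvf x)).
Qed.

Section Lattice.

Variables (V : vectType E) (L : {pred V}) (n : nat) (b : n.-tuple V).
Hypothesis Lb : coord_basis_of L b.

Let b_basis : basis_of fullv b := Lb.1.
Let L_coord x : x \in L <-> forall i, v (coord b i x) <= 1 := Lb.2 x.

Lemma lattice_basis_mem i : b`_i \in L.
Proof.
(* Beyond the length of [b], [nth] returns 0, which also lies in [L]. *)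
have [i_lt|i_ge] := ltnP i n; last first.
  by rewrite nth_default ?size_tuple //; apply/L_coord=> j; rewrite linear0 absval0.
apply/L_coord=> j; rewrite -[i]/(nat_of_ord (Ordinal i_lt)).
rewrite coord_free ?(basis_free b_basis) //.
by case: eqP => _; rewrite ?absval0 ?absval1.
Qed.

Lemma latticeD x y : x \in L -> y \in L -> x + y \in L.
Proof.
move=> /L_coord xL /L_coord yL; apply/L_coord=> i; rewrite linearD.
by apply: le_trans (absvalD _ _) _; rewrite ge_max xL yL.
Qed.

Lemma latticeZ k x : v k <= 1 -> x \in L -> k *: x \in L.
Proof.
move=> kU /L_coord xL; apply/L_coord=> i; rewrite linearZ absvalM.
by rewrite mulr_ile1 ?absval_ge0 ?xL.
Qed.

Lemma lattice0 : 0 \in L.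
Proof. by apply/L_coord=> i; rewrite linear0 absval0. Qed.

Lemma latticeB x y : x \in L -> y \in L -> x - y \in L.
Proof.
by move=> xL yL; rewrite -scaleN1r latticeD // latticeZ // absvalN absval1.
Qed.

Lemma lattice_sum m (c : 'I_m -> E) (x : 'I_m -> V) :
  (forall i, v (c i) <= 1) -> (forall i, x i \in L) -> \sum_i c i *: x i \in L.
Proof.
move=> cU xL; elim/big_ind: _ => [||i _]; [exact: lattice0 | exact: latticeD |].
exact: latticeZ.
Qed.

Lemma in_ideal_mul_coord x :
  in_ideal_mul (valideal v) L x <-> forall i, v (coord b i x) < 1.
Proof.
split=> [[m [c [y [cP yL ->]]]] i | xP].
  rewrite linear_sum; apply: absval_sum_lt => // j; rewrite linearZ absvalM.
  have /L_coord/(_ i) yU := yL j; have cj : v (c j) < 1 := cP j.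
  by apply: le_lt_trans cj; rewrite ler_piMr ?absval_ge0.
exists n, (fun i => coord b i x), (fun i => b`_i); split=> //.
  by move=> i; apply: lattice_basis_mem.
exact: coord_basis (memvf x).
Qed.

Section Reduction.

Variables (F : fieldType) (red : E -> F).
Hypothesis red_residue : residue_map (valring v) (valideal v) red.
Variables (W : vectType F) (g : V -> W).
Hypothesis g_red : lattice_reduction (valring v) (valideal v) red L g.

Lemma reductionD x y : x \in L -> y \in L -> g (x + y) = g x + g y.
Proof. by case: g_red => + _ _ _; apply. Qed.

Lemma reductionZ k x : v k <= 1 -> x \in L -> g (k *: x) = red k *: g x.
Proof. by case: g_red => _ + _ _; apply. Qed.

Lemma reduction_eq0 x : x \in L -> (g x = 0 <-> forall i, v (coord b i x) < 1).
Proof.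
move=> xL; case: g_red => _ _ _ /(_ x xL) g0; split.
  by move=> /g0 /in_ideal_mul_coord.
by move=> /in_ideal_mul_coord /g0.
Qed.

Lemma reduction0 : g 0 = 0.
Proof. by apply/reduction_eq0=> [|i]; rewrite ?lattice0 // linear0 absval0. Qed.

Lemma reductionB x y : x \in L -> y \in L -> g (x - y) = g x - g y.
Proof.
move=> xL yL; apply: (addIr (g y)).
by rewrite -reductionD ?latticeB // !subrK.
Qed.

Lemma reduction_sum m (c : 'I_m -> E) (x : 'I_m -> V) :
  (forall i, v (c i) <= 1) -> (forall i, x i \in L) ->
  g (\sum_i c i *: x i) = \sum_i red (c i) *: g (x i).
Proof.
elim: m c x => [|m IHm] c x cU xL; first by rewrite !big_ord0 reduction0.
rewrite !big_ord_recl reductionD ?latticeZ ?lattice_sum // reductionZ //.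
by rewrite IHm.
Qed.

Lemma reduction_free m (X : m.-tuple V) :
  (forall i : 'I_m, X`_i \in L) -> free (map g X) -> free X.
Proof.
move=> XL gX_free; apply/freeP=> c c0; apply: contrapT => /existsNP[i ci].
have [|d [j [d_neq0 dU dj]]] := @absval_normalize m c.
  by exists i; apply/eqP.
have [red1 _ _ _ _] := red_residue.
have gdc0 : \sum_k red (d * c k) *: (map g X)`_k = 0.
  transitivity (g (d *: \sum_k c k *: X`_k)).
    rewrite scaler_sumr; under [in RHS]eq_bigr do rewrite scalerA.
    rewrite reduction_sum //; apply: eq_bigr => k _.
    by rewrite (nth_map 0) ?size_tuple.
  by rewrite c0 scaler0 reduction0.
have /freeP/(_ (fun k => red (d * c k)) gdc0 j)/eqP := gX_free.
by rewrite dj red1 oner_eq0.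
Qed.

Lemma reduction_section : exists s : W -> V, forall w, s w \in L /\ g (s w) = w.
Proof.
have [_ _ gsurj _] := g_red.
have sP w : exists x, x \in L /\ g x = w by have [x xL xw] := gsurj w; exists x.
by have [s] := choice sP; exists s.
Qed.

(** Lift a basis of the image of [h] to [L] and apply [f]. As [h] is a projection, the result still
    reduces to that basis, so it is free. *)
Lemma dim_limg_reduction_le (f : 'End(V)) (h : 'End(W)) :
  (forall x, x \in L -> f x \in L) -> (forall x, x \in L -> g (f x) = h (g x)) ->
  (forall y, h (h y) = h y) -> (\dim (limg h) <= \dim (limg f))%N.
Proof.
move=> fL fh hh; have [s sP] := reduction_section.
pose X := [tuple of map (fun w => f (s w)) (vbasis (limg h))].
have XE i : (i < \dim (limg h))%N -> X`_i = f (s (vbasis (limg h))`_i).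
  by move=> i_lt; rewrite (nth_map 0) ?size_tuple.
have gX : map g X = vbasis (limg h).
  apply: (@eq_from_nth _ 0) => [|i]; first by rewrite size_map !size_tuple.
  rewrite size_map size_tuple => i_lt; rewrite (nth_map 0) ?size_tuple // XE //.
  have [sL gs] := sP (vbasis (limg h))`_i; rewrite fh // gs.
  by apply/eqP; rewrite -mem_limg_idem // vbasis_mem // mem_nth // size_tuple.
have Xfree : free X.
  apply: reduction_free => [i|]; last by rewrite gX (basis_free (vbasisP _)).
  rewrite XE ?ltn_ord //; apply: fL; exact: (sP _).1.
have <- : \dim <<X>> = \dim (limg h) by move: Xfree; rewrite /free size_tuple => /eqP.
apply/dimvS/span_subvP => _ /mapP[w _ ->].
by rewrite memv_img ?memvf.
Qed.

(** The lattice basis stays free after reduction: a relation lifts to an element of [L] with image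
    0, whose coordinates lie in P. *)
Lemma dim_lattice_reduction_le : (\dim {:V} <= \dim {:W})%N.
Proof.
have [_ _ _ redsurj redP] := red_residue.
have gb_free : free [tuple of map g b].
  apply/freeP=> c c0 i.
  have [d dP] := choice (fun j => let (x, xU, xc) := redsurj (c j) in
    ex_intro (fun x => x \in valring v /\ red x = c j) x (conj xU xc)).
  have dU j : v (d j) <= 1 by case: (dP j).
  have := lattice_sum dU (fun j => lattice_basis_mem j); set x := \sum_j _ => xL.
  have /(reduction_eq0 xL)/(_ i) : g x = 0.
    rewrite reduction_sum // => [|j]; last exact: lattice_basis_mem.
    rewrite -[RHS]c0; apply: eq_bigr => j _; have [_ ->] := dP j.
    by rewrite (nth_map 0) ?size_tuple.
  rewrite coord_sum_free ?(basis_free b_basis) // => di.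
  by have [dU' <-] := dP i; apply/redP.
have -> : \dim {:V} = \dim <<[tuple of map g b]>>.
  by rewrite (eqP gb_free) size_map size_tuple (size_basis b_basis).
exact: dimvS (subvf _).
Qed.

(** The rank inequality holds for [f], [h] and for their complements; adding up and comparing with
    dim V <= dim W forces equality. *)
Lemma dim_limg_reduction (f : 'End(V)) (h : 'End(W)) :
  (forall x, x \in L -> f x \in L) -> (forall x, x \in L -> g (f x) = h (g x)) ->
  (forall x, f (f x) = f x) -> (forall y, h (h y) = h y) ->
  \dim (limg f) = \dim (limg h).
Proof.
move=> fL fh ff hh.
pose f' := \1%VF - f; pose h' := \1%VF - h.
have f'E x : f' x = x - f x by rewrite add_lfunE opp_lfunE id_lfunE.
have h'E y : h' y = y - h y by rewrite add_lfunE opp_lfunE id_lfunE.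
have le1 := dim_limg_reduction_le fL fh hh.
have le2 : (\dim (limg h') <= \dim (limg f'))%N.
  apply: dim_limg_reduction_le => [x xL|x xL|y].
  - by rewrite f'E latticeB ?fL.
  - by rewrite f'E h'E reductionB ?fL // fh.
  by rewrite !h'E linearB /= hh subrr subr0.
have := dim_lattice_reduction_le.
rewrite (dim_limg_idem ff) (dim_limg_idem hh) => le3.
apply/eqP; rewrite eqn_leq le1 andbT -(leq_add2l (\dim (limg f'))).
by apply: leq_trans le3 _; rewrite leq_add2r.
Qed.

End Reduction.
End Lattice.
End Absval.


(** * Algebraic closedness of the residue field *)

Section ResidueField.

Variables (R : realType) (E : closedFieldType) (v : E -> R).
Hypothesis v_absval : nonarch_absval v.
Variables (F : fieldType) (red : E -> F).
Hypothesis red_residue : residue_map (valring v) (valideal v) red.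

Lemma residue_field_closed : GRing.closed_field_axiom F.
Proof.
move=> n c n_gt0; have [red1 redD redM redsurj redP] := red_residue.
have [d dP] := choice (fun i => let (x, xU, xc) := redsurj (c i) in
  ex_intro (fun x => x \in valring v /\ red x = c i) x (conj xU xc)).
have dU i : v (d i) <= 1 by case: (dP i).
have [x xE] := solve_monicpoly d n_gt0.
(* A root of a monic integral equation is integral: if [v x > 1], the terms of degree below [n] are
   at most [v x ^+ n.-1], too small to equal [x ^+ n]. *)
have xU : v x <= 1.
  rewrite leNgt; apply/negP=> x_gt1.
  have vx_gt0 : 0 < v x := lt_trans ltr01 x_gt1.
  have : v (x ^+ n) <= v x ^+ n.-1.
    rewrite xE; apply: absval_sum_le => // [|i]; first by rewrite exprn_ge0 ?ltW.
    rewrite absvalM // absvalX // -[leRHS]mul1r.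
    rewrite ler_pM ?exprn_ge0 ?absval_ge0 // ler_weXn2l ?(ltW x_gt1) //.
    by rewrite -ltnS prednK.
  rewrite absvalX // leNgt => /negP; apply.
  by rewrite ltr_eXn2l // prednK.
have XU i : x ^+ i \in valring v by rewrite inE absvalX // exprn_ile1 ?absval_ge0.
have redX i : red (x ^+ i) = red x ^+ i.
  elim: i => [|i IHi]; first by rewrite !expr0.
  by rewrite !exprS redM ?IHi ?XU.
exists (red x); rewrite -redX xE.
have red0 : red 0 = 0 by apply/redP; rewrite inE absval0 ?ler01 ?ltr01.
elim: n {n_gt0 xE} => [|n IHn]; first by rewrite !big_ord0.
have [dnU dn] := dP n.
rewrite !big_ord_recr redD /=.
- by rewrite IHn redM ?XU // dn redX.
- rewrite inE; apply: absval_sum_le => // i; rewrite absvalM //.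
  by rewrite mulr_ile1 ?absval_ge0 // -/(_ \in valring v); have := XU i; rewrite inE.
rewrite inE absvalM // mulr_ile1 ?absval_ge0 //.
by have := XU n; rewrite inE.
Qed.

End ResidueField.

(** * Lifting idempotents *)

Section IdempotentLifting.

Variables (R : realType) (E : fieldType) (v : E -> R).
Hypotheses (v_absval : nonarch_absval v) (v_complete : absval_complete v).
Variables (A : falgType E) (D : {pred A}) (n : nat) (b : n.-tuple A).
Hypotheses (D_ring : subring_closed D) (Db : coord_basis_of v D b).

Definition coord_le (c : R) (x : A) : Prop := forall i, v (coord b i x) <= c.

Let b_basis : basis_of fullv b := Db.1.

Lemma coord_leD c x y : coord_le c x -> coord_le c y -> coord_le c (x + y).
Proof.
move=> xc yc i; rewrite linearD; apply: le_trans (absvalD v_absval _ _) _.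
by rewrite ge_max xc yc.
Qed.

Lemma coord_leN c x : coord_le c x -> coord_le c (- x).
Proof. by move=> xc i; rewrite linearN absvalN //; apply: xc. Qed.

Lemma coord_le_trans c d x : c <= d -> coord_le c x -> coord_le d x.
Proof. by move=> cd xc i; apply: le_trans cd. Qed.

Lemma coord_le0 c : 0 <= c -> coord_le c 0.
Proof. by move=> c_ge0 i; rewrite linear0 absval0. Qed.

Lemma coord_leP x : x \in D <-> coord_le 1 x.
Proof. exact: Db.2. Qed.

(** The sup norm is submultiplicative because [D] is a ring: products of basis elements have
    integral coordinates. *)
Lemma coord_leM c d x y : 0 <= c -> 0 <= d ->
  coord_le c x -> coord_le d y -> coord_le (c * d) (x * y).
Proof.
move=> c_ge0 d_ge0 xc yd i; have [_ _ DM] := D_ring.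
have cd_ge0 : 0 <= c * d by rewrite mulr_ge0.
rewrite (coord_basis b_basis (memvf x)) mulr_suml linear_sum /=.
apply: absval_sum_le => // j.
rewrite (coord_basis b_basis (memvf y)) mulr_sumr linear_sum /=.
apply: absval_sum_le => // k.
have -> : coord b i (coord b j x *: b`_j * (coord b k y *: b`_k)) =
    coord b j x * coord b k y * coord b i (b`_j * b`_k).
  by rewrite -scalerAl -scalerAr scalerA linearZ.
rewrite !absvalM // -[leRHS]mulr1.
apply: ler_pM; rewrite ?mulr_ge0 ?absval_ge0 //.
  by apply: ler_pM; rewrite ?absval_ge0.
by move: i; apply/coord_leP/DM; apply: (lattice_basis_mem v_absval Db).
Qed.

Lemma coord_le_lt1 x :
  (forall i, v (coord b i x) < 1) -> exists c, [/\ 0 <= c, c < 1 & coord_le c x].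
Proof.
move=> x_lt1; pose c := \big[Num.max/0]_i v (coord b i x).
exists c; split; first exact: bigmax_ge_id.
  by apply: bigmax_lt.
by move=> i; apply: (le_bigmax _ (fun i => v (coord b i x))).
Qed.

(* x - (x^2 - x)(2x - 1) = 3x^2 - 2x^3 *)
Definition newton_idem (x : A) : A := x - (x * x - x) * (x *+ 2 - 1).

(** A Newton step squares the defect x^2 - x up to an integral factor. The identity involves [x]
    alone, so it is checked in polynomials, where [ring] applies, and evaluated at [x]. *)
Lemma newton_idemE x :
  newton_idem x * newton_idem x - newton_idem x =
    (x * x - x) * (x * x - x) * ((x * x - x) *+ 4 - 3%:R).
Proof.
have pE (S : comNzRingType) (t : S) (p := t - (t * t - t) * (t *+ 2 - 1)) :
    p * p - p = (t * t - t) * (t * t - t) * ((t * t - t) *+ 4 - 3%:R).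
  by rewrite /p; ring.
have /(congr1 (horner_alg x)) := pE _ ('X : {poly E}).
by rewrite !(rmorphB, rmorphM, rmorphMn, rmorph1) /= !horner_algX.
Qed.

Lemma idempotent_lift (x : A) :
  x \in D -> (forall i, v (coord b i (x * x - x)) < 1) ->
  exists e : A, [/\ e \in D, e * e = e & forall i, v (coord b i (e - x)) < 1].
Proof.
move=> xD /coord_le_lt1[c [c_ge0 c_lt1 yc]].
have [D1 DB DM] := D_ring; pose u k := iter k newton_idem x.
have D0 : 0 \in D by rewrite -(subrr 1) DB.
have DN z : z \in D -> - z \in D by move=> zD; rewrite -sub0r DB.
have DD z t : z \in D -> t \in D -> z + t \in D.
  by move=> zD tD; rewrite -[t]opprK DB ?DN.
have DMn z k : z \in D -> z *+ k \in D.
  by move=> zD; elim: k => [|k IHk]; rewrite ?mulr0n // mulrS DD.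
have uD k : u k \in D.
  by elim: k => [|k IHk] //=; rewrite /newton_idem !(DB, DM, DMn).
have c_exp k : 0 <= c ^+ k by rewrite exprn_ge0.
(* The convergence is quadratic, but this weaker geometric bound suffices. *)
have uc k : coord_le (c ^+ k.+1) (u k * u k - u k).
  elim: k => [|k IHk]; first by rewrite expr1.
  rewrite /= newton_idemE; apply: (@coord_le_trans (c ^+ k.+1 * c ^+ k.+1 * 1)).
    rewrite mulr1 -exprD ler_wiXn2l ?(ltW c_lt1) //.
    by rewrite addnS ltnS leq_addr.
  apply: coord_leM; rewrite ?mulr_ge0 //; first exact: coord_leM.
  by apply/coord_leP; rewrite !(DB, DM, DMn).
have uS k : coord_le (c ^+ k.+1) (u k.+1 - u k).
  rewrite /= /newton_idem addrAC subrr add0r -[c ^+ _]mulr1.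
  apply: coord_leN; apply: coord_leM => //.
  by apply/coord_leP; rewrite !(DB, DM, DMn).
(* By the ultrametric inequality, a sum of steps is no larger than the bound on the first one. *)
have uDk k m : coord_le (c ^+ k.+1) (u (k + m)%N - u k).
  elim: m => [|m IHm]; first by rewrite addn0 subrr; apply: coord_le0.
  rewrite addnS -(subrK (u (k + m)%N) (u _.+1)) -addrA; apply: coord_leD IHm.
  apply: coord_le_trans (uS _).
  by rewrite ler_wiXn2l ?(ltW c_lt1) // ltnS leq_addr.
have limP i : exists l : E, forall e : R, 0 < e ->
    exists N : nat, forall k, (N <= k)%N -> v (coord b i (u k) - l) < e.
  apply: v_complete => e e_gt0; have [N cN] := exists_expr_lt c_ge0 c_lt1 e_gt0.
  have uN k : (N <= k)%N -> v (coord b i (u k) - coord b i (u N)) < e.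
    move=> /subnKC <-; rewrite -linearB; apply: le_lt_trans (uDk _ _ _) _.
    by apply: le_lt_trans cN; rewrite ler_wiXn2l ?(ltW c_lt1).
  exists N => k m Nk Nm; rewrite -(subrK (coord b i (u N)) (coord b i (u k))).
  rewrite -addrA; apply: le_lt_trans (absvalD v_absval _ _) _.
  by rewrite gt_max uN // -(absvalN v_absval) opprB uN.
have [l lP] := choice limP; pose e : A := \sum_i l i *: b`_i.
(* Otherwise some later iterate would be closer to the limit than the excessive distance, against
   the ultrametric inequality and [uDk]. *)
have ec k : coord_le (c ^+ k.+1) (e - u k).
  move=> i; rewrite linearB /= coord_sum_free ?(basis_free b_basis) //.
  rewrite leNgt; apply/negP => lt_v.
  have [N uN] := lP i _ (le_lt_trans (c_exp k.+1) lt_v).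
  have := uN (k + N)%N (leq_addl _ _); apply/negP; rewrite -leNgt.
  have := absvalD v_absval (coord b i (u (k + N)%N) - coord b i (u k))
    (l i - coord b i (u (k + N)%N)).
  rewrite addrC subrKA le_max -linearB -[v (l i - coord b i (u (k + N)%N))]absvalN //.
  rewrite opprB => /orP[le_v|//]; have := le_trans le_v (uDk k N i).
  by rewrite leNgt lt_v.
have eD : e \in D.
  rewrite -(subrK (u 0%N) e) DD //; apply/coord_leP.
  by apply: coord_le_trans (ec 0%N); rewrite expr1 ltW.
exists e; split=> // [|i]; last first.
  by apply: le_lt_trans c_lt1; rewrite -[c]expr1; apply: (ec 0%N).
(* Comparison with [u k] bounds the defect of [e] for every [k]; since the powers of [c] tend to 0,
   the defect is 0. *)
have eec k : coord_le (c ^+ k.+1) (e * e - e).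
  have -> : e * e - e = (e - u k) * e + u k * (e - u k) + (u k * u k - u k) - (e - u k).
    by rewrite mulrBl mulrBr opprB !subrKA.
  apply: coord_leD; last exact: coord_leN.
  do 2![apply: coord_leD => //].
    by rewrite -[c ^+ _]mulr1; apply: coord_leM => //; apply/coord_leP.
  by rewrite -[c ^+ _]mul1r; apply: coord_leM => //; apply/coord_leP.
apply/eqP; rewrite -subr_eq0 (coord_basis b_basis (memvf (e * e - e))).
apply/eqP/big1 => i _; rewrite (_ : coord b i _ = 0) ?scale0r //.
apply: contrapT => /eqP /(absval_gt0 v_absval) d_gt0.
have [N cN] := exists_expr_lt c_ge0 c_lt1 d_gt0.
have cS : c ^+ N.+1 <= c ^+ N by rewrite ler_wiXn2l ?(ltW c_lt1).
by have := le_lt_trans (eec N i) (le_lt_trans cS cN); rewrite ltxx.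
Qed.

End IdempotentLifting.


(** Any preimage [x] of [ebar] in [D] has x^2 - x in P D, and the idempotent found near [x] differs
    from it by an element of P D. *)
Lemma idempotent_reduction_lift (R : realType) (E : fieldType) (v : E -> R)
    (F : fieldType) (red : E -> F) (A : falgType E) (D : {pred A})
    (Dbar : falgType F) (redD : A -> Dbar) (ebar : Dbar) :
  nonarch_absval v -> absval_complete v -> is_order (valring v) D ->
  order_reduction (valring v) (valideal v) red D redD -> ebar * ebar = ebar ->
  exists e : A, [/\ e \in D, e * e = e & redD e = ebar].
Proof.
move=> v_absval v_complete [D_ring /(full_lattice_basis v_absval)[n [b Db]]].
move=> [D_red _ redDM] ee; have [_ _ redDsurj _] := D_red; have [D1 DB DM] := D_ring.
have [x xD xe] := redDsurj ebar.
have xx0 i : v (coord b i (x * x - x)) < 1.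
  move: i; apply/(reduction_eq0 v_absval Db D_red); first by rewrite DB ?DM.
  by rewrite (reductionB v_absval Db D_red) ?DM // redDM // xe ee subrr.
have [e [eD e_idem ex]] := idempotent_lift v_absval v_complete D_ring Db xD xx0.
exists e; split=> //; apply/eqP; rewrite -subr_eq0 -xe.
rewrite -(reductionB v_absval Db D_red) //; apply/eqP.
by apply/(reduction_eq0 v_absval Db D_red); rewrite ?DB.
Qed.

(** * Comparison of the Cartan matrices *)

Theorem theorem5
  (R : realType) (E : closedFieldType) (v : E -> R)
  (v_absval : nonarch_absval v) (v_complete : absval_complete v)
  (F : fieldType) (red : E -> F)
  (red_residue : residue_map (valring v) (valideal v) red)
  (p : nat) (F_pchar : p \in [pchar F])
  (A : falgType E) (D : {pred A}) (D_order : is_order (valring v) D)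
  (Dbar : falgType F) (redD : A -> Dbar)
  (Dbar_reduction : order_reduction (valring v) (valideal v) red D redD)
  (r : nat) (P T : 'I_r -> amodule A)
  (P_pims : full_set_of_pims P) (T_heads : forall i, is_head (P i) (T i))
  (s : nat) (Q S : 'I_s -> amodule Dbar)
  (Q_pims : full_set_of_pims Q) (S_heads : forall j, is_head (Q j) (S j))
  (L : forall i : 'I_r, {pred T i})
  (L_stable : forall i, stable_lattice (valring v) D (L i))
  (Tbar : 'I_r -> amodule Dbar) (redT : forall i : 'I_r, T i -> Tbar i)
  (Tbar_reduction : forall i,
     module_reduction (valring v) (valideal v) red D redD (L i) (redT i)) :
  cartan_hom_mx Q =
    (decomposition_mx Tbar S)^T *m cartan_mx P T *m decomposition_mx Tbar S.
Proof.
have closedE : GRing.closed_field_axiom E := @solve_monicpoly E.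
have closedF := residue_field_closed v_absval red_residue.
have idem j : exists e ebar (q : Q j),
    [/\ presents ebar q, e \in D, e * e = e & redD e = ebar].
  have [Qpim _ _] := Q_pims; have [ebar [q Qq]] := pim_presents (Qpim j).
  have [ee _ _ _] := Qq.
  have [e [eD e_idem eE]] :=
    idempotent_reduction_lift v_absval v_complete D_order Dbar_reduction ee.
  by exists e, ebar, q.
have [D_ring /(full_lattice_basis v_absval)[n [b Db]]] := D_order.
have [D_red _ redDM] := Dbar_reduction; have [D1 DB DM] := D_ring.
(* The action of [e] on the lattice [L k] reduces to that of [ebar] on [Tbar k]; both are
   projections, so their ranks agree. *)
have decompE j e ebar (q : Q j) : presents ebar q -> e \in D -> e * e = e ->
    redD e = ebar ->
    forall k, \dim (idem_part (T k) e) = decomposition_mx Tbar S k j.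
  move=> Qq eD ee eE k; rewrite mxE (comp_mult_head closedF _ Qq (S_heads j)).
  have [/(full_lattice_basis v_absval)[m [c Lc]] Lstable] := L_stable k.
  have [T_red redTA] := Tbar_reduction k; have [eebar _ _ _] := Qq.
  apply: (dim_limg_reduction v_absval Lc red_residue T_red) => [x|x|x|y].
  - exact: Lstable.
  - by move=> xL; rewrite redTA // eE.
  - by rewrite -actME ee.
  by rewrite -actME eebar.
apply/matrixP=> i j; rewrite mxE.
have [ei [eibar [qi [Qi eiD eei eiE]]]] := idem i.
have [ej [ejbar [qj [Qj ejD eej ejE]]]] := idem j.
have [[eeib _ _ _] [eejb _ _ _]] := (Qi, Qj).
rewrite (dim_hom_presents _ Qj) -(dim_corner_presents eejb Qi).
have <- : \dim (corner ej ei) = \dim (corner ejbar eibar).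
  apply: (dim_limg_reduction v_absval Db red_residue D_red) => [x|x|x|y].
  - by move=> xD; rewrite corner_lfunE !DM.
  - by move=> xD; rewrite !corner_lfunE !redDM ?DM // ejE eiE.
  - by rewrite !corner_lfunE -!mulrA eei !mulrA eej.
  by rewrite !corner_lfunE -!mulrA eeib !mulrA eejb.
(* With the product bracketed as D^T (C D), the outer sum over [l] is the expansion of e_j A e_i,
   and the inner sum over [k] that of e_j P_l. *)
rewrite (dim_corner_sum closedE P_pims T_heads eej eei) -mulmxA mxE.
apply: eq_bigr => l _; rewrite mxE (decompE _ _ _ _ Qi) //; congr (_ * _).
rewrite (dim_idem_part_sum closedE P_pims T_heads _ eej) mxE.
apply: eq_bigr => k _; rewrite (decompE _ _ _ _ Qj) // [RHS]mulrC.
by rewrite [cartan_mx _ _ _ _]mxE.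
Qed.
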